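(* Let $\mathcal{B}\subset\mathscr{B}(G)$ be a von Neumann algebra acting non-degenerately on a Hilbert space $G$, let $E$ be a Hilbert $\mathcal{B}$-module, let $H=E\odot G$, and let $\rho'\colon\mathcal{B}'\to\mathscr{B}(H)$ be the representation $\rho'(b')=\mathrm{id}_E\odot b'$ of the commutant $\mathcal{B}'$ of $\mathcal{B}$. Then the Hilbert $\mathcal{B}$-module $$C_{\mathcal{B}'}(\mathscr{B}(G,H))=\{x\in\mathscr{B}(G,H)\colon \rho'(b')x=xb'\text{ for all }b'\in\mathcal{B}'\}$$ is self-dual, i.e. for every bounded right $\mathcal{B}$-linear mapping $\Phi\colon C_{\mathcal{B}'}(\mathscr{B}(G,H))\to\mathcal{B}$ there is a (unique) $y\in C_{\mathcal{B}'}(\mathscr{B}(G,H))$ such that $\Phi x=\langle y,x\rangle$ for all $x\in C_{\mathcal{B}'}(\mathscr{B}(G,H))$.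
   Context: $\mathscr{B}(G)$ denotes all bounded operators on $G$, and $\mathscr{B}(G,H)$ all bounded operators $G\to H$. Inner products are linear in the second argument. For a (right) Hilbert module $E$ over $\mathcal{B}\subset\mathscr{B}(G)$, the Hilbert space $H=E\odot G$ is the interior tensor product over $\mathcal{B}$, i.e. the completion of the span of elementary tensors $x\odot g$ ($x\in E$, $g\in G$) with inner product $\langle x_1\odot g_1,x_2\odot g_2\rangle=\langle g_1,\langle x_1,x_2\rangle g_2\rangle$ (modulo null vectors). For $b'\in\mathcal{B}'$, $\rho'(b')=\mathrm{id}_E\odot b'$ is the bounded operator on $H$ determined by $x\odot g\mapsto x\odot b'g$; $\rho'$ is a normal unital representation of $\mathcal{B}'$ on $H$. $C_{\mathcal{B}'}(\mathscr{B}(G,H))$ is a Hilbert $\mathcal{B}$-module with right action $(x,b)\mapsto xb$ (composition of operators) and inner product $\langle x,y\rangle=x^*y\in\mathcal{B}$. *)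

(* Defs.v *)
From HB Require Import structures.
From mathcomp Require Import all_boot all_order all_algebra.
From mathcomp Require Import all_classical all_reals all_analysis.
From mathcomp Require Export complex.

Set Implicit Arguments.
Unset Strict Implicit.
Unset Printing Implicit Defensive.
Import Order.TTheory GRing.Theory Num.Theory.
Import numFieldNormedType.Exports.

Local Open Scope classical_set_scope.
Local Open Scope ring_scope.
Local Open Scope complex_scope.

(* Complex Hilbert spaces: the inner product is linear in the second argument
   and induces the norm. *)
HB.mixin Record CompleteNormedModule_isHilbert (R : realType) H
    of CompleteNormedModule R[i] H := {
  hdot : H -> H -> R[i] ;
  hdotDr : forall x y z : H, hdot x (y + z) = hdot x y + hdot x z ;
  hdotZr : forall (a : R[i]) (x y : H), hdot x (a *: y) = a * hdot x y ;
  hdotC : forall x y : H, hdot y x = (hdot x y)^* ;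
  hdot_norm : forall x : H, hdot x x = `|x| ^+ 2
}.

#[short(type="hilbertType")]
HB.structure Definition Hilbert (R : realType) :=
  {H of CompleteNormedModule_isHilbert R H & CompleteNormedModule R[i] H}.

Section Operators.
Context {R : realType}.

(* Operators are plain functions, so that sums, scalar multiples and products
   of operators are the pointwise operations and the composition \o. *)
Definition bounded_op (V W : normedModType R[i]) : set (V -> W) :=
  [set T | linear T /\ exists c : R, forall v, `|T v| <= c%:C * `|v|].

Definition opnorm (V W : normedModType R[i]) (T : V -> W) : R :=
  sup [set complex.Re `|T v| | v in [set v : V | `|v| <= 1]].

Definition adjoint (G H : hilbertType R) (T : G -> H) : H -> G :=
  xget 0 [set S | forall g h, hdot h (T g) = hdot (S h) g].

Definition lspan (V : lmodType R[i]) (A : set V) : set V :=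
  [set v | exists n (a : 'I_n -> R[i]) (w : 'I_n -> V),
     (forall i, A (w i)) /\ v = \sum_(i < n) a i *: w i].

End Operators.

Section VonNeumannAlgebras.
Context {R : realType} {G : hilbertType R}.

(* Not assumed to contain the identity; the last field is closedness in the
   strong operator topology. *)
Record von_neumann_algebra (B : set (G -> G)) : Prop := VonNeumannAlgebra {
  vna_bounded : B `<=` @bounded_op R G G ;
  vna0 : B 0 ;
  vnaD : forall b c, B b -> B c -> B (b + c) ;
  vnaZ : forall (a : R[i]) b, B b -> B (a *: b) ;
  vnaM : forall b c, B b -> B c -> B (b \o c) ;
  vna_adjoint : forall b, B b -> B (adjoint b) ;
  vna_closed : forall T : G -> G, bounded_op T ->
    (forall n (g : 'I_n -> G) (e : R), 0 < e ->
       exists2 b, B b & forall i, `|T (g i) - b (g i)| < e%:C) ->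
    B T
}.

Definition acts_nondegenerately (B : set (G -> G)) : Prop :=
  dense (lspan [set h : G | exists b g, B b /\ h = b g]).

Definition commutant (B : set (G -> G)) : set (G -> G) :=
  [set T | bounded_op T /\ forall b, B b -> b \o T = T \o b].

End VonNeumannAlgebras.

(* The action and the inner product involve B as a set of operators on G; the
   value of the action outside B is irrelevant. *)
Record hilbertModule (R : realType) (G : hilbertType R) (B : set (G -> G)) :=
    HilbertModule {
  hm_sort :> completeNormedModType R[i] ;
  hm_act : hm_sort -> (G -> G) -> hm_sort ;
  hm_ip : hm_sort -> hm_sort -> G -> G ;
  hm_actDl : forall x y b, B b -> hm_act (x + y) b = hm_act x b + hm_act y b ;
  hm_actDr : forall x b c, B b -> B c ->
    hm_act x (b + c) = hm_act x b + hm_act x c ;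
  hm_actZl : forall (a : R[i]) x b, B b -> hm_act (a *: x) b = a *: hm_act x b ;
  hm_actZr : forall (a : R[i]) x b, B b -> hm_act x (a *: b) = a *: hm_act x b ;
  hm_actA : forall x b c, B b -> B c ->
    hm_act x (b \o c) = hm_act (hm_act x b) c ;
  hm_ip_in : forall x y, B (hm_ip x y) ;
  hm_ipDr : forall x y z, hm_ip x (y + z) = hm_ip x y + hm_ip x z ;
  hm_ipZr : forall (a : R[i]) x y, hm_ip x (a *: y) = a *: hm_ip x y ;
  hm_ip_act : forall x y b, B b -> hm_ip x (hm_act y b) = hm_ip x y \o b ;
  hm_ipC : forall x y, hm_ip y x = adjoint (hm_ip x y) ;
  hm_ip_ge0 : forall x g, 0 <= hdot g (hm_ip x x g) ;
  hm_norm : forall x, `|x| ^+ 2 = (opnorm (hm_ip x x))%:C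
}.

Section InteriorTensor.
Context {R : realType} {G : hilbertType R} {B : set (G -> G)}.
Context {E : hilbertModule B} {H : hilbertType R}.

(* H, with t x g in the role of the elementary tensor of x and g, is the
   Hilbert space completion of the span of the elementary tensors modulo null
   vectors.  Bilinearity of t follows from the inner product formula. *)
Record interior_tensor (t : E -> G -> H) : Prop := InteriorTensor {
  itensor_dot : forall x1 g1 x2 g2,
    hdot (t x1 g1) (t x2 g2) = hdot g1 (hm_ip x1 x2 g2) ;
  itensor_dense : dense (lspan [set h : H | exists x g, h = t x g])
}.

Definition commutant_rep (t : E -> G -> H) (b' : G -> G) : H -> H :=
  xget 0 [set T | bounded_op T /\ forall x g, T (t x g) = t x (b' g)].

Definition intertwiners (t : E -> G -> H) : set (G -> H) :=
  [set x | bounded_op x /\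
     forall b', commutant B b' -> commutant_rep t b' \o x = x \o b'].

End InteriorTensor.

Section SelfDual.
Context {R : realType} {G : hilbertType R}.
Variables (B : set (G -> G)) (V : lmodType R[i]) (M : set V).
Variables (act : V -> (G -> G) -> V) (ip : V -> V -> G -> G).

(* Bounded right B-linear maps from the Hilbert B-module (M, act, ip) to B, for
   the module norm; complex homogeneity is automatic since B is unital when it
   acts non-degenerately.  Only the restriction of Phi to M matters. *)
Definition bounded_right_linear (Phi : V -> G -> G) : Prop :=
  [/\ forall x, M x -> B (Phi x),
      forall x y, M x -> M y -> Phi (x + y) = Phi x + Phi y,
      forall x b, M x -> B b -> Phi (act x b) = Phi x \o b &
      exists c : R, forall x, M x ->
        opnorm (Phi x) <= c * Num.sqrt (opnorm (ip x x))].

Definition self_dual : Prop :=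
  forall Phi, bounded_right_linear Phi ->
  exists! y, M y /\ forall x, M x -> Phi x = ip y x.

End SelfDual.

(* Main.v *)
Require Import Defs.
From mathcomp Require Import all_boot all_order all_algebra.
From mathcomp Require Import all_classical all_reals all_analysis.
From mathcomp Require Import ring lra.

Set Implicit Arguments.
Unset Strict Implicit.
Unset Printing Implicit Defensive.
Import Order.TTheory GRing.Theory Num.Theory.
Import numFieldNormedType.Exports.

Local Open Scope classical_set_scope.
Local Open Scope ring_scope.
Local Open Scope complex_scope.

(* A bounded right linear Phi satisfies |Phi(x) g| <= c |x g| for every vector g
   (Paschke), by testing the norm bound on x b with b close to
   (x^* x + e)^(-1/2).  Splitting G by projections of the commutant onto cyclic
   subspaces of B upgrades this to |sum Phi(x_i) g_i| <= c |sum x_i g_i|, so that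
   x g |-> Phi(x) g extends from the span of the x g, which contains the
   elementary tensors and hence is dense, to a bounded operator H -> G.  Its
   adjoint is y.  That <x, y> = x^* y lies in B is the bicommutant theorem. *)

(** The obstacle is that a bound on single vectors [x g] says nothing about sums over different
    vectors. If all g_i lie near B g_0, say g_i close to b_i g_0, then the sum of the x_i g_i is
    close to z g_0 for the single module element z = sum x_i b_i, and B-linearity of Phi gives the
    same approximation for the sum of the Phi(x_i) g_i. What remains after projecting is orthogonal
    to this piece both in H and in G, because x_i^* x_j and Phi(x_i)^* Phi(x_j) lie in B and commute
    with the projection. By Pythagoras the constant c therefore survives for any number of vectors.
    Square roots and inverses enter only through approximants built by algebraic operations with
    explicit errors. They exist in every unital star-algebra of bounded operators: in B they give
    Paschke's inequality, and in the commutant a square root shows that id (x) b' is bounded. The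
    adjoint y intertwines because Phi takes values in B, which commutes with B'; it is unique
    because each map g |-> x (x) g is itself an intertwiner. *)

(** * Norms and inner products as real numbers *)

Section RealNorm.
Context {R : realType}.

Lemma ReD (x y : R[i]) : complex.Re (x + y) = complex.Re x + complex.Re y.
Proof. by case: x; case: y. Qed.

Lemma ReCM (a : R) (x : R[i]) : complex.Re (a%:C * x) = a * complex.Re x.
Proof. by case: x => x y /=; rewrite mul0r subr0. Qed.

(** Limiting arguments end here: [C] may have any sign, so error terms are simply collected in
    it. *)
Lemma le_of_eps (a b C : R) :
  (forall e, 0 < e -> a <= b + e * C) -> a <= b.
Proof.
move=> h; rewrite leNgt; apply/negP => ab.
have C0 : 0 < `|C| + 1 by rewrite ltr_pwDr.
have e0 : 0 < (a - b) / (`|C| + 1) by rewrite divr_gt0// subr_gt0.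
have := h _ e0; set e := _ / _.
have : e * C <= e * `|C| by rewrite ler_wpM2l ?ler_norm// ltW.
have -> : e * `|C| = a - b - e by rewrite /e; field; lra.
rewrite -/e in e0; lra.
Qed.

Lemma expr_small (q : R) (e : R) : 0 <= q < 1 -> 0 < e -> exists m, q ^+ m < e.
Proof.
move=> /andP[q0 q1] e0.
have /cvgrPdist_lt/(_ _ e0)[m _ /(_ m (leqnn m))] : q ^+ n @[n --> \oo] --> 0.
  by apply: cvg_expr; rewrite ger0_norm.
by rewrite sub0r normrN ger0_norm ?exprn_ge0// => ?; exists m.
Qed.

Section Normed.
Context {V : normedModType R[i]}.
Implicit Types u v w : V.

(** Norms take values in [R[i]]; passing to [R] makes all estimates accessible to real
    arithmetic. *)
Definition rnorm v : R := complex.Re `|v|.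

Lemma rnormE v : `|v| = (rnorm v)%:C.
Proof. by rewrite /rnorm RRe_real// ger0_real. Qed.

Lemma rnorm_ge0 v : 0 <= rnorm v.
Proof. by rewrite -lecR -rnormE; exact: normr_ge0. Qed.

Lemma rnormD u v : rnorm (u + v) <= rnorm u + rnorm v.
Proof. by rewrite -lecR rmorphD/= -!rnormE ler_normD. Qed.

Lemma rnormZ (a : R[i]) v : rnorm (a *: v) = complex.Re `|a| * rnorm v.
Proof.
rewrite /rnorm normrZ -(@RRe_real _ `|a|) ?ger0_real//.
by rewrite ReCM /=.
Qed.

Lemma rnormZr (a : R) v : 0 <= a -> rnorm (a%:C *: v) = a * rnorm v.
Proof. by move=> a0; rewrite rnormZ ger0_norm ?lecR. Qed.

Lemma rnormN v : rnorm (- v) = rnorm v.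
Proof. by rewrite /rnorm normrN. Qed.

Lemma rnormB u v : rnorm (u - v) <= rnorm u + rnorm v.
Proof. by rewrite -(rnormN v) rnormD. Qed.

Lemma rdistC u v : rnorm (u - v) = rnorm (v - u).
Proof. by rewrite -rnormN opprB. Qed.

Lemma rdist_triangle v u w : rnorm (u - w) <= rnorm (u - v) + rnorm (v - w).
Proof. by rewrite -[u - w](subrKA v) rnormD. Qed.

Lemma rnorm0 : rnorm (0 : V) = 0.
Proof. by rewrite /rnorm normr0. Qed.

Lemma rnorm_eq0 v : rnorm v = 0 -> v = 0.
Proof. by move=> h; apply/eqP; rewrite -normr_eq0 rnormE h. Qed.

Lemma rnorm_small v : (forall e, 0 < e -> rnorm v <= e) -> v = 0.
Proof.
move=> h; apply: rnorm_eq0; apply/eqP; rewrite eq_le rnorm_ge0 andbT.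
by apply: (@le_of_eps _ _ 1) => e /h; rewrite add0r mulr1.
Qed.

Lemma denseP (S : set V) : dense S <->
  forall h e, 0 < e -> exists2 s, S s & rnorm (h - s) < e.
Proof.
split=> [dS h e e0|hS O [h Oh] oO].
  have [|s [hs Ss]] := dS (ball h e%:C) _ (ball_open _ _).
    by exists h; apply: ballxx; rewrite ltcR.
  exists s => //; move: hs.
  by rewrite -ball_normE /ball_/= rnormE ltcR.
have /nbhs_ballP[e /= e0 he] : nbhs h O by exact: open_nbhs_nbhs.
have eE : e = (complex.Re e)%:C by rewrite RRe_real ?gtr0_real.
have e0' : 0 < complex.Re e by rewrite -ltcR -eE.
have [s Ss hs] := hS h _ e0'.
exists s; split => //; apply: he.
by rewrite -ball_normE /ball_/= rnormE eE ltcR.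
Qed.

End Normed.

Lemma complete_rnorm (V : completeNormedModType R[i]) (u : nat -> V) :
  (forall e, 0 < e ->
     exists n0, forall m n, (n0 <= m)%N -> (n0 <= n)%N -> rnorm (u m - u n) < e) ->
  exists l, forall e, 0 < e ->
     exists n0, forall n, (n0 <= n)%N -> rnorm (l - u n) < e.
Proof.
move=> h.
have /cvg_ex[l /cvgrPdist_lt hl] : cvg (u @ \oo).
  apply/cauchy_cvgP/cauchy_ballP => e e0.
  have eE : e = (complex.Re e)%:C by rewrite RRe_real ?gtr0_real.
  have e0' : 0 < complex.Re e by rewrite -ltcR -eE.
  have [n0 hn0] := h _ e0'.
  exists (u @` [set n | (n0 <= n)%N], u @` [set n | (n0 <= n)%N]) => /=.
    by split; exists n0 => // n /= hn; exists n.
  move=> [a b] /= [[m hm <-] [n hn <-]].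
  by rewrite -ball_normE /ball_/= rnormE eE ltcR hn0.
exists l => e e0.
have e0C : 0 < e%:C by rewrite ltcR.
have [n0 _ hn0] := hl _ e0C; exists n0 => n hn.
by have := hn0 n hn; rewrite /= rnormE ltcR.
Qed.

End RealNorm.

Section RealDot.
Context {R : realType} {G : hilbertType R}.
Implicit Types u v w : G.

Lemma hdotDl u v w : hdot (u + v) w = hdot u w + hdot v w.
Proof. by rewrite hdotC hdotDr rmorphD/= -!hdotC. Qed.

Lemma hdotZl (a : R[i]) u v : hdot (a *: u) v = conjc a * hdot u v.
Proof. by rewrite hdotC hdotZr rmorphM/= -hdotC. Qed.

(** A symmetric real bilinear form. No information is lost, since [Im_hdot] recovers the imaginary
    part by multiplying the second argument by i. *)
Definition rdot u v : R := complex.Re (hdot u v).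

Lemma rdotC u v : rdot u v = rdot v u.
Proof. by rewrite /rdot hdotC; case: (hdot v u). Qed.

Lemma rdotDr u v w : rdot u (v + w) = rdot u v + rdot u w.
Proof. by rewrite /rdot hdotDr ReD. Qed.

Lemma rdotDl u v w : rdot (u + v) w = rdot u w + rdot v w.
Proof. by rewrite /rdot hdotDl ReD. Qed.

Lemma rdotZr (a : R) u v : rdot u (a%:C *: v) = a * rdot u v.
Proof. by rewrite /rdot hdotZr ReCM. Qed.

Lemma rdotZl (a : R) u v : rdot (a%:C *: u) v = a * rdot u v.
Proof. by rewrite rdotC rdotZr rdotC. Qed.

Lemma rdotZC (a : R[i]) u v : rdot u (a *: v) = rdot (conjc a *: u) v.
Proof. by rewrite /rdot hdotZr hdotZl conjcK. Qed.

Lemma rdotNr u v : rdot u (- v) = - rdot u v.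
Proof. by rewrite -scaleN1r -(rmorphN1 (real_complex R)) rdotZr mulN1r. Qed.

Lemma rdotNl u v : rdot (- u) v = - rdot u v.
Proof. by rewrite rdotC rdotNr rdotC. Qed.

Lemma rdotBr u v w : rdot u (v - w) = rdot u v - rdot u w.
Proof. by rewrite rdotDr rdotNr. Qed.

Lemma rdotBl u v w : rdot (u - v) w = rdot u w - rdot v w.
Proof. by rewrite rdotDl rdotNl. Qed.

Lemma rdot0r u : rdot u 0 = 0.
Proof. by rewrite -(subrr u) rdotBr subrr. Qed.

Lemma rdot0l u : rdot 0 u = 0.
Proof. by rewrite rdotC rdot0r. Qed.

Lemma rdot_norm u : rdot u u = rnorm u ^+ 2.
Proof. by rewrite /rdot hdot_norm rnormE -rmorphXn. Qed.

(** Cauchy-Schwarz, from expanding the squared norm of |v| u - |u| v. *)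
Lemma rdot_le u v : rdot u v <= rnorm u * rnorm v.
Proof.
have [->|u0] := eqVneq u 0; first by rewrite rdot0l rnorm0 mul0r.
have [->|v0] := eqVneq v 0; first by rewrite rdot0r rnorm0 mulr0.
have gt0 (w : G) : w != 0 -> 0 < rnorm w.
  move=> w0; rewrite lt_def rnorm_ge0 andbT.
  by apply: contra w0 => /eqP/rnorm_eq0 ->.
have := sqr_ge0 (rnorm ((rnorm v)%:C *: u - (rnorm u)%:C *: v)).
rewrite -rdot_norm rdotBl !rdotBr !rdotZl !rdotZr (rdotC v u) !rdot_norm => h.
have uv := mulr_gt0 (gt0 _ u0) (gt0 _ v0).
rewrite -(ler_pM2l uv); nra.
Qed.

Lemma rdot_norm_le u v : `|rdot u v| <= rnorm u * rnorm v.
Proof.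
by rewrite ler_norml rdot_le andbT lerNl -rdotNr -(rnormN v) rdot_le.
Qed.

Lemma rdot_inj u v : (forall w, rdot u w = rdot v w) -> u = v.
Proof.
move=> h; apply/eqP; rewrite -subr_eq0; apply/eqP/rnorm_eq0/eqP.
by rewrite -sqrf_eq0 -rdot_norm rdotBl h subrr.
Qed.

Lemma Im_hdot u v : complex.Im (hdot u v) = - rdot u ('i *: v).
Proof. by rewrite /rdot hdotZr; case: (hdot u v) => a b /=; ring. Qed.

End RealDot.

Lemma hdot_rdot (R : realType) (G H : hilbertType R)
    (u : G) (v : H) (T : G -> H) :
  (forall a w, T (a *: w) = a *: T w) ->
  (forall w, rdot v (T w) = rdot u w) -> forall w, hdot v (T w) = hdot u w.
Proof.
move=> TZ h w; apply/eqP; rewrite eq_complex -![complex.Re _]/(rdot _ _) h eqxx/=.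
by rewrite !Im_hdot -TZ h.
Qed.

(** * Riesz representation and adjoints *)

Section Families.
Context {R : realType} {G : hilbertType R} {n : nat}.
Implicit Types u v w k : 'I_n -> G.

(** The real inner product of the n-fold sum G^n, on which the bicommutant theorem is proved. *)
Definition sdot u v : R := \sum_(i < n) rdot (u i) (v i).

Lemma sdotC u v : sdot u v = sdot v u.
Proof. by apply: eq_bigr => i _; rewrite rdotC. Qed.

Lemma sdotDr u v w : sdot u (fun i => v i + w i) = sdot u v + sdot u w.
Proof. by rewrite -big_split; apply: eq_bigr => i _; rewrite rdotDr. Qed.

Lemma sdotBr u v w : sdot u (fun i => v i - w i) = sdot u v - sdot u w.
Proof. by rewrite -sumrB; apply: eq_bigr => i _; rewrite rdotBr. Qed.

Lemma sdotZr (a : R) u v : sdot u (fun i => a%:C *: v i) = a * sdot u v.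
Proof. by rewrite mulr_sumr; apply: eq_bigr => i _; rewrite rdotZr. Qed.

Lemma sdotDl u v w : sdot (fun i => u i + v i) w = sdot u w + sdot v w.
Proof. by rewrite sdotC sdotDr !(sdotC w). Qed.

Lemma sdotBl u v w : sdot (fun i => u i - v i) w = sdot u w - sdot v w.
Proof. by rewrite sdotC sdotBr !(sdotC w). Qed.

Lemma sdotZl (a : R) u v : sdot (fun i => a%:C *: u i) v = a * sdot u v.
Proof. by rewrite sdotC sdotZr (sdotC v). Qed.

Lemma sdot_coord u i : rnorm (u i) ^+ 2 <= sdot u u.
Proof.
rewrite /sdot (bigD1 i)//= -rdot_norm lerDl sumr_ge0// => j _.
by rewrite rdot_norm sqr_ge0.
Qed.

Lemma sdot_ge0 u : 0 <= sdot u u.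
Proof. by apply: sumr_ge0 => i _; rewrite rdot_norm sqr_ge0. Qed.

Lemma sdot_near u v k e : (forall i, rnorm (u i - v i) <= e) ->
  `|sdot u k - sdot v k| <= e * \sum_(i < n) rnorm (k i).
Proof.
move=> uv; rewrite mulr_sumr -sumrB (le_trans (ler_norm_sum _ _ _))//.
apply: ler_sum => i _; rewrite -rdotBl (le_trans (rdot_norm_le _ _))//.
by rewrite ler_wpM2r ?rnorm_ge0.
Qed.

(* The minimiser of q k - 2 f k over the closure of K, where q is the squared
   norm: f := sdot u gives the orthogonal projection, and n = 1, K = setT gives
   the Riesz representation theorem. *)
Lemma riesz_subspace (K : set ('I_n -> G)) (f : ('I_n -> G) -> R) (C : R) :
  K (fun=> 0) ->
  (forall k l, K k -> K l -> K (fun i => k i + l i)) ->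
  (forall (a : R) k, K k -> K (fun i => a%:C *: k i)) ->
  (forall k l, f (fun i => k i + l i) = f k + f l) ->
  (forall (a : R) k, f (fun i => a%:C *: k i) = a * f k) ->
  (forall k, K k -> C <= sdot k k - 2 * f k) ->
  exists w, (forall e, 0 < e -> exists2 k, K k & forall i, rnorm (w i - k i) < e)
    /\ forall k, K k -> sdot w k = f k.
Proof.
move=> K0 KD KZ fD fZ bd.
pose J k := sdot k k - 2 * f k.
pose A := [set J k | k in K].
have lbA : has_lbound A by exists C => _ [k Kk <-]; exact: bd.
have infA : has_inf A by split => //; exists (J (fun=> 0)), (fun=> 0).
pose d := inf A.
have dJ k : K k -> d <= J k by move=> Kk; apply: ge_inf => //; exists k.
have adh (m : nat) : exists k, K k /\ J k < d + 2^-1 ^+ m.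
  have [|_ [k Kk <-] hk] := @inf_adherent _ A (2^-1 ^+ m) _ infA; last by exists k.
  by rewrite exprn_gt0// invr_gt0.
have [k /all_and2[Kk Jk]] := choice adh.
have half m m0 : (m0 <= m)%N -> (2^-1 : R) ^+ m <= 2^-1 ^+ m0.
  by move=> h; rewrite ler_wiXn2l// ?invr_ge0// invf_le1// ler1n.
(* Parallelogram law: the linear part of [J] cancels, and [J] at the midpoint is at least [d].
   Minimising sequences are therefore Cauchy. *)
have par x y : K x -> K y ->
    sdot (fun i => x i - y i) (fun i => x i - y i) <= 2 * J x + 2 * J y - 4 * d.
  move=> Kx Ky; have := dJ _ (KZ 2^-1 _ (KD _ _ Kx Ky)).
  rewrite /J fZ fD sdotBl !sdotBr sdotZl sdotZr sdotDl !sdotDr (sdotC y x); lra.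
have cau i e : 0 < e -> exists n0, forall m m', (n0 <= m)%N -> (n0 <= m')%N ->
    rnorm (k m i - k m' i) < e.
  move=> e0; have [||n0 hn0] := @expr_small _ 2^-1 (e ^+ 2 / 4).
  - by rewrite invr_ge0 ler0n invf_lt1// ltr1n.
  - by rewrite divr_gt0// exprn_gt0.
  exists n0 => m m' hm hm'.
  rewrite -(ltr_pXn2r (ltn0Sn 1)) ?nnegrE ?rnorm_ge0 ?(ltW e0)//.
  apply: le_lt_trans (sdot_coord (fun i => k m i - k m' i) i) _.
  apply: le_lt_trans (par _ _ (Kk m) (Kk m')) _.
  have := Jk m; have := Jk m'; have := half _ _ hm; have := half _ _ hm'; lra.
have [w wl] := choice (fun i => complete_rnorm (cau i)).
have near e : 0 < e -> exists k, [/\ K k, J k < d + e &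
    forall i, rnorm (w i - k i) < e].
  move=> e0; have [||n0 hn0] := @expr_small _ 2^-1 e => //.
    by rewrite invr_ge0 ler0n invf_lt1// ltr1n.
  have [N NP] := choice (fun i => wl i e e0).
  pose m := maxn n0 (\max_i N i); exists (k m); split => //.
    by apply: lt_trans (Jk m) _; rewrite ltrD2l (le_lt_trans _ hn0)// half// leq_maxl.
  by move=> i; apply: NP; rewrite leq_max (leq_bigmax i) orbT.
exists w; split=> [e e0|z Kz]; first by have [x []] := near e e0; exists x.
set D := \sum_(i < n) rnorm (z i).
(* First-order condition at the minimiser: compare [J] at x and at x + s z for x in [K] near [w],
   then let x tend to [w]. *)
have key s : 0 <= s ^+ 2 * sdot z z + 2 * s * (sdot w z - f z).
  apply: (@le_of_eps _ _ _ (1 + 2 * `|s| * D)) => e e0.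
  have [x [Kx Jx wx]] := near e e0.
  have := dJ _ (KD _ _ Kx (KZ s _ Kz)).
  have wxz : `|sdot w z - sdot x z| <= e * D by apply: sdot_near => i; exact: ltW.
  have : s * (sdot x z - sdot w z) <= `|s| * (e * D).
    by rewrite (le_trans (ler_norm _))// normrM distrC ler_wpM2l.
  rewrite /J in Jx *.
  rewrite fD fZ sdotDl !sdotDr !sdotZl !sdotZr (sdotC z x).
  rewrite expr2; lra.
set q := sdot z z in key *; set b := sdot w z - f z in key *.
have q0 : 0 <= q by exact: sdot_ge0.
have b0 : b = 0.
  have q1 : 0 < q + 1 by lra.
  (* The optimal choice would be - b / q; adding 1 covers the case q = 0. *)
  have := key (- b / (q + 1)).
  have -> : (- b / (q + 1)) ^+ 2 * q + 2 * (- b / (q + 1)) * b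
    = - (b / (q + 1)) ^+ 2 * (q + 2) by field; lra.
  rewrite mulNr oppr_ge0 pmulr_lle0 ?ltr_wpDl// => h.
  have /eqP : (b / (q + 1)) ^+ 2 = 0 by apply/eqP; rewrite eq_le h sqr_ge0.
  by rewrite sqrf_eq0 mulf_eq0 invr_eq0 (gt_eqF q1) orbF => /eqP.
by apply/eqP; rewrite -subr_eq0 -/b b0.
Qed.

End Families.

Section Bounded.
Context {R : realType}.
Implicit Types V W X : normedModType R[i].

Lemma bounded_opP V W (T : V -> W) : bounded_op T <->
  linear T /\ exists2 c : R, 0 <= c & forall v, rnorm (T v) <= c * rnorm v.
Proof.
split=> -[lT].
  move=> [c hc]; split => //; exists `|c| => // v.
  have := hc v; rewrite !rnormE -rmorphM/= lecR => /le_trans; apply.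
  by rewrite ler_wpM2r ?rnorm_ge0 ?ler_norm.
by move=> [c _ hc]; split => //; exists c => v; rewrite !rnormE -rmorphM/= lecR.
Qed.

Lemma bounded_op_bound V W (T : V -> W) : bounded_op T ->
  exists2 c : R, 0 <= c & forall v, rnorm (T v) <= c * rnorm v.
Proof. by move=> /bounded_opP[]. Qed.

Lemma bounded_opD V W (T : V -> W) : bounded_op T -> forall u v, T (u + v) = T u + T v.
Proof. by case=> lT _ u v; rewrite -[u]scale1r lT !scale1r. Qed.

Lemma bounded_op0 V W (T : V -> W) : bounded_op T -> T 0 = 0.
Proof.
by move=> bT; apply: (addrI (T 0)); rewrite -(bounded_opD bT) !addr0.
Qed.

Lemma bounded_opZ V W (T : V -> W) : bounded_op T ->
  forall (a : R[i]) v, T (a *: v) = a *: T v.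
Proof.
by move=> bT a v; rewrite -[a *: v]addr0 bT.1 (bounded_op0 bT) addr0.
Qed.

Lemma bounded_opB V W (T : V -> W) : bounded_op T -> forall u v, T (u - v) = T u - T v.
Proof.
by move=> bT u v; rewrite -[- v]scaleN1r (bounded_opD bT) (bounded_opZ bT) scaleN1r.
Qed.

Lemma bounded_op_sum V W (T : V -> W) : bounded_op T ->
  forall n (f : 'I_n -> V), T (\sum_(i < n) f i) = \sum_(i < n) T (f i).
Proof.
move=> bT n f; elim/big_rec2: _ => [|i a v _ <-]; first exact: bounded_op0.
by rewrite (bounded_opD bT).
Qed.

Lemma bounded_comp V W X (S : W -> X) (T : V -> W) :
  bounded_op S -> bounded_op T -> @bounded_op R V X (S \o T).
Proof.
move=> bS bT; apply/bounded_opP; split.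
  by move=> a u v /=; rewrite bT.1 bS.1.
have [s s0 hs] := bounded_op_bound bS; have [t t0 ht] := bounded_op_bound bT.
exists (s * t) => [|v /=]; first exact: mulr_ge0.
by rewrite (le_trans (hs _))// -mulrA ler_wpM2l.
Qed.

Lemma bounded_add V W (S T : V -> W) :
  bounded_op S -> bounded_op T -> bounded_op (S + T).
Proof.
move=> bS bT; apply/bounded_opP; split.
  by move=> a u v; rewrite !fctE bT.1 bS.1 scalerDr addrACA.
have [s s0 hs] := bounded_op_bound bS; have [t t0 ht] := bounded_op_bound bT.
exists (s + t) => [|v]; first exact: addr_ge0.
by rewrite !fctE (le_trans (rnormD _ _))// mulrDl lerD.
Qed.

Lemma bounded_scale V W (a : R[i]) (T : V -> W) :
  bounded_op T -> bounded_op (a *: T).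
Proof.
move=> bT; apply/bounded_opP; split.
  by move=> b u v; rewrite !fctE bT.1 scalerDr !scalerA mulrC.
have [t t0 ht] := bounded_op_bound bT.
have a0 : 0 <= complex.Re `|a| by rewrite -lecR RRe_real ?ger0_real ?normr_ge0//; exact: normr_ge0.
exists (complex.Re `|a| * t) => [|v]; first exact: mulr_ge0.
by rewrite !fctE rnormZ -mulrA ler_wpM2l.
Qed.

Lemma bounded_id V : @bounded_op R V V id.
Proof. by apply/bounded_opP; split => //; exists 1 => // v; rewrite mul1r. Qed.

Lemma bounded_op_eq0 V W (T : V -> W) : bounded_op T ->
  forall S : set V, dense S -> (forall v, S v -> T v = 0) -> forall v, T v = 0.
Proof.
move=> bT S /denseP dS TS v; apply: rnorm_small => e e0.
have [c c0 hc] := bounded_op_bound bT.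
have c1 : 0 < c + 1 by lra.
have [s Ss hs] := dS v _ (divr_gt0 e0 c1).
have -> : T v = T (v - s) by rewrite (bounded_opB bT) (TS s)// subr0.
apply: le_trans (hc _) _.
apply: (@le_trans _ _ ((c + 1) * (e / (c + 1)))); last by rewrite mulrCA mulfV ?mulr1 ?gt_eqF.
by apply: ler_pM => //; rewrite ?rnorm_ge0 ?ltW//; lra.
Qed.

End Bounded.

Section Adjoint.
Context {R : realType}.
Implicit Types G H : hilbertType R.

Lemma adjoint_exists G H (T : G -> H) : bounded_op T ->
  forall h, exists w, forall v, hdot h (T v) = hdot w v.
Proof.
move=> bT h; have [c c0 hc] := bounded_op_bound bT.
(* The lower bound is the minimum of r^2 - 2 c |h| r over real r. *)
have [||||||w [_ wP]] := @riesz_subspace R G 1 setT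
    (fun k => rdot h (T (k ord0))) (- (c * rnorm h) ^+ 2) => //.
- by move=> k l; rewrite (bounded_opD bT) rdotDr.
- by move=> a k; rewrite (bounded_opZ bT) rdotZr.
- move=> k _; rewrite /sdot big_ord1 rdot_norm; set u := k ord0.
  have h1 : rdot h (T u) <= c * rnorm h * rnorm u.
    by rewrite (le_trans (rdot_le _ _))// [leRHS]mulrAC mulrC ler_wpM2r ?rnorm_ge0.
  have := sqr_ge0 (rnorm u - c * rnorm h).
  rewrite sqrrB; lra.
exists (w ord0) => v; apply: (hdot_rdot (bounded_opZ bT)) => {}v.
by have := wP (fun=> v) I; rewrite /sdot big_ord1 => ->.
Qed.

Lemma adjointP G H (T : G -> H) : bounded_op T ->
  forall h g, hdot h (T g) = hdot (adjoint T h) g.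
Proof.
move=> bT h g; have [S hS] := choice (adjoint_exists bT).
suff : [set S | forall g h, hdot h (T g) = hdot (S h) g] (adjoint T) by exact.
by apply: (@xgetPex _ _ [set S | forall g h, hdot h (T g) = hdot (S h) g]); exists S.
Qed.

Lemma radjointP G H (T : G -> H) : bounded_op T ->
  forall h g, rdot h (T g) = rdot (adjoint T h) g.
Proof. by move=> bT h g; rewrite /rdot adjointP. Qed.

Lemma adjoint_uniq G H (T : G -> H) (S : H -> G) : bounded_op T ->
  (forall h g, rdot h (T g) = rdot (S h) g) -> adjoint T = S.
Proof.
by move=> bT hS; apply/funext => h; apply: rdot_inj => g; rewrite -hS radjointP.
Qed.

(** |T^* h|^2 = <h, T T^* h> <= c |h| |T^* h|. *)
Lemma adjoint_bound G H (T : G -> H) (c : R) : bounded_op T -> 0 <= c ->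
  (forall v, rnorm (T v) <= c * rnorm v) ->
  forall h, rnorm (adjoint T h) <= c * rnorm h.
Proof.
move=> bT c0 hc h; have [h0|h0] := eqVneq (rnorm (adjoint T h)) 0.
  by rewrite h0 mulr_ge0 ?rnorm_ge0.
rewrite -(@ler_pM2r _ (rnorm (adjoint T h))) ?lt_def ?h0 ?rnorm_ge0//.
rewrite -expr2 -rdot_norm -radjointP// (le_trans (rdot_le _ _))// [leRHS]mulrAC mulrC.
by rewrite ler_wpM2r ?rnorm_ge0.
Qed.

Lemma adjoint_bounded G H (T : G -> H) : bounded_op T -> bounded_op (adjoint T).
Proof.
move=> bT; apply/bounded_opP; split; last first.
  have [c c0 hc] := bounded_op_bound bT; exists c => // h; exact: adjoint_bound.
move=> a u v; apply: rdot_inj => g; rewrite -radjointP// rdotDl rdotDl.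
by rewrite -radjointP// -(conjcK a) -!rdotZC -radjointP// (bounded_opZ bT).
Qed.

Lemma adjointK G H (T : G -> H) : bounded_op T -> adjoint (adjoint T) = T.
Proof.
move=> bT; apply: adjoint_uniq; first exact: adjoint_bounded.
by move=> g h; rewrite rdotC -radjointP// rdotC.
Qed.

End Adjoint.

(** * Cyclic projections and the bicommutant theorem *)

Section Spans.
Context {R : realType} {G : hilbertType R}.

Lemma hdot0l (u : G) : hdot 0 u = 0.
Proof. by rewrite -(scale0r 0) hdotZl conjc0 mul0r. Qed.

Lemma hdot_sumr (u : G) n (f : 'I_n -> G) :
  hdot u (\sum_(i < n) f i) = \sum_(i < n) hdot u (f i).
Proof.
elim/big_rec2: _ => [|i a v _ <-]; last by rewrite hdotDr.
by rewrite -(scale0r 0) hdotZr mul0r.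
Qed.

Lemma dense_lspan_eq0 (S : set G) (u : G) : dense (lspan S) ->
  (forall s, S s -> hdot u s = 0) -> u = 0.
Proof.
move=> /denseP dS uS; apply: rnorm_eq0; apply/eqP; rewrite -sqrf_eq0.
rewrite eq_le sqr_ge0 andbT; apply: (@le_of_eps _ _ _ (rnorm u)) => e e0.
have [s [n [a [w [Sw ->]]]] us] := dS u _ e0.
have us0 : rdot u (\sum_(i < n) a i *: w i) = 0.
  by rewrite /rdot hdot_sumr big1// => i _; rewrite hdotZr uS ?mulr0.
rewrite add0r -rdot_norm -[leLHS]subr0 -us0 -rdotBr mulrC.
by rewrite (le_trans (rdot_le _ _))// ler_wpM2l ?rnorm_ge0// ltW.
Qed.

End Spans.

Section StarAlgebras.
Context {R : realType} {G : hilbertType R}.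
Implicit Types A B : set (G -> G).

(** The algebraic part common to [B] and its commutant, so that the constructions below apply to
    both. Strong closedness of [B] enters only through [bicommutant]. *)
Record star_algebra A : Prop := StarAlgebra {
  sa_bounded : A `<=` @bounded_op R G G ;
  sa0 : A 0 ;
  saD : forall b c, A b -> A c -> A (b + c) ;
  saZ : forall (a : R[i]) b, A b -> A (a *: b) ;
  saM : forall b c, A b -> A c -> A (b \o c) ;
  sa_adjoint : forall b, A b -> A (adjoint b)
}.

Lemma von_neumann_star_algebra B : von_neumann_algebra B -> star_algebra B.
Proof. by case=> *; split. Qed.

Lemma commutantP B T : commutant B T <->
  bounded_op T /\ forall b, B b -> forall g, b (T g) = T (b g).
Proof.
split=> -[bT h]; split => // b Bb; last by apply/funext => g; exact: h.
by move=> g; have /(congr1 (fun f => f g)) := h b Bb.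
Qed.

Lemma commutant_star_algebra B : star_algebra B -> star_algebra (commutant B).
Proof.
move=> sB; split.
- by move=> b [].
- apply/commutantP; split; last by move=> b /(sa_bounded sB) /bounded_op0.
  apply/bounded_opP; split; first by move=> a u v; rewrite scaler0 addr0.
  by exists 0 => // v; rewrite rnorm0 mul0r.
- move=> b c /commutantP[bb hb] /commutantP[bc hc]; apply/commutantP; split.
    exact: bounded_add.
  move=> d Bd g; rewrite !fctE (bounded_opD (sa_bounded sB Bd)).
  by rewrite hb// hc.
- move=> a b /commutantP[bb hb]; apply/commutantP; split.
    exact: bounded_scale.
  by move=> d Bd g; rewrite !fctE (bounded_opZ (sa_bounded sB Bd)) hb.
- move=> b c /commutantP[bb hb] /commutantP[bc hc]; apply/commutantP; split.
    exact: bounded_comp.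
  by move=> d Bd g /=; rewrite hb// hc.
- move=> b /commutantP[bb hb]; apply/commutantP; split.
    exact: adjoint_bounded.
  move=> d Bd g; have bd := sa_bounded sB Bd; apply: rdot_inj => h.
  have bd' := adjoint_bounded bd; have := hb _ (sa_adjoint sB Bd) h.
  move=> /(congr1 (rdot g)); rewrite (radjointP bd') (adjointK bd).
  by rewrite (radjointP bb) [in X in _ = X -> _](radjointP bb) (radjointP bd') (adjointK bd).
Qed.

(** [h] is orthogonal to the total set of all [b g], since <h, b g> = <b^* h, g>. *)
Lemma nondegenerate_eq0 B (h : G) : star_algebra B -> acts_nondegenerately B ->
  (forall b, B b -> b h = 0) -> h = 0.
Proof.
move=> sB nB bh; apply: (dense_lspan_eq0 nB) => _ [b [g [Bb ->]]].
rewrite adjointP; last exact: sa_bounded Bb.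
by rewrite bh ?hdot0l//; exact: sa_adjoint.
Qed.

Section CyclicProjection.
Context {A : set (G -> G)} (sA : star_algebra A) {n : nat} (gs : 'I_n -> G).
Implicit Types u v w : 'I_n -> G.

(** The closure in G^n of the orbit of [gs] under the diagonal action of [A]: one [b] serves all
    coordinates. *)
Definition in_cyclic w := forall e : R, 0 < e ->
  exists2 b, A b & forall i, rnorm (w i - b (gs i)) < e.

(** Real and complex orthogonality agree here, as [A] is closed under complex scalars. *)
Definition orth_cyclic v := forall b, A b -> sdot v (fun i => b (gs i)) = 0.

Let bdd b (Ab : A b) := sa_bounded sA Ab.

Lemma in_cyclicD v w : in_cyclic v -> in_cyclic w -> in_cyclic (fun i => v i + w i).
Proof.
move=> hv hw e e0; have e2 : 0 < e / 2 by rewrite divr_gt0.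
have [b Ab hb] := hv _ e2; have [c Ac hc] := hw _ e2.
exists (b + c) => [|i]; first exact: saD.
rewrite !fctE opprD addrACA (le_lt_trans (rnormD _ _))//.
by have := hb i; have := hc i; lra.
Qed.

Lemma in_cyclic_bounded (c : G -> G) w : bounded_op c ->
  (forall b, A b -> exists2 b', A b' & forall g, c (b g) = b' g) ->
  in_cyclic w -> in_cyclic (fun i => c (w i)).
Proof.
move=> bc cA hw e e0; have [k k0 hk] := bounded_op_bound bc.
have k1 : 0 < k + 1 by lra.
have [b Ab hb] := hw _ (divr_gt0 e0 k1).
have [b' Ab' hb'] := cA b Ab; exists b' => // i.
rewrite -hb' -(bounded_opB bc) (le_lt_trans (hk _))//.
have := hb i; rewrite ltr_pdivlMr// => hi.
by rewrite (le_lt_trans _ hi)// mulrC ler_wpM2l ?rnorm_ge0//; lra.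
Qed.

Lemma in_cyclicZ (a : R[i]) w : in_cyclic w -> in_cyclic (fun i => a *: w i).
Proof.
apply: (@in_cyclic_bounded (a *: id)); first exact/bounded_scale/bounded_id.
by move=> b Ab; exists (a *: b) => //; exact: saZ.
Qed.

Lemma in_cyclicM b w : A b -> in_cyclic w -> in_cyclic (fun i => b (w i)).
Proof.
move=> Ab; apply: in_cyclic_bounded; first exact: bdd.
by move=> c Ac; exists (b \o c) => //; exact: saM.
Qed.

Lemma orth_cyclicD v w : orth_cyclic v -> orth_cyclic w ->
  orth_cyclic (fun i => v i + w i).
Proof. by move=> hv hw b Ab; rewrite sdotDl hv// hw// addr0. Qed.

Lemma orth_cyclicZ (a : R[i]) v : orth_cyclic v -> orth_cyclic (fun i => a *: v i).
Proof.
move=> hv b Ab; rewrite -[RHS](hv (conjc a *: b)); last exact: saZ.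
by apply: eq_bigr => i _; rewrite rdotZC conjcK.
Qed.

Lemma orth_cyclicM b v : A b -> orth_cyclic v -> orth_cyclic (fun i => b (v i)).
Proof.
move=> Ab hv c Ac; rewrite -[RHS](hv (adjoint b \o c)); last first.
  by apply: saM => //; exact: sa_adjoint.
apply: eq_bigr => i _; rewrite rdotC radjointP; last exact: bdd.
by rewrite rdotC.
Qed.

Lemma in_orth_cyclic v w : orth_cyclic v -> in_cyclic w -> sdot v w = 0.
Proof.
move=> hv hw; apply/eqP; rewrite -normr_eq0 eq_le normr_ge0 andbT.
apply: (@le_of_eps _ _ _ (\sum_(i < n) rnorm (v i))) => e e0.
have [b Ab hb] := hw _ e0.
rewrite add0r -[X in `|X|]subr0 -[X in _ - X](hv _ Ab) !(sdotC v).
by apply: sdot_near => i; exact: ltW.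
Qed.

Lemma in_orth_cyclic_eq0 w : in_cyclic w -> orth_cyclic w -> forall i, w i = 0.
Proof.
move=> iw ow i; apply: rnorm_eq0; apply/eqP; rewrite -sqrf_eq0 eq_le sqr_ge0 andbT.
by rewrite -(in_orth_cyclic ow iw) sdot_coord.
Qed.

Lemma cyclic_decomposition u :
  exists w, in_cyclic w /\ orth_cyclic (fun i => u i - w i).
Proof.
have [||||||w [iw hw]] := @riesz_subspace R G n
    [set k | exists2 b, A b & k = fun i => b (gs i)] (sdot u) (- sdot u u).
- by exists 0; first exact: sa0.
- move=> _ _ [b Ab ->] [c Ac ->]; exists (b + c) => //; exact: saD.
- move=> a _ [b Ab ->]; exists (a%:C *: b) => //; exact: saZ.
- by move=> k l; rewrite sdotDr.
- by move=> a k; rewrite sdotZr.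
- move=> k _; have := sdot_ge0 (fun i => u i - k i).
  by rewrite sdotBl !sdotBr (sdotC k u); lra.
exists w; split.
  by move=> e /iw[_ [b Ab ->] hb]; exists b.
by move=> b Ab; rewrite sdotBl hw ?subrr//; exists b.
Qed.

Definition cyclic_proj u := projT1 (cid (cyclic_decomposition u)).

Lemma cyclic_proj_in u : in_cyclic (cyclic_proj u).
Proof. by rewrite /cyclic_proj; case: cid => w []. Qed.

Lemma cyclic_proj_orth u : orth_cyclic (fun i => u i - cyclic_proj u i).
Proof. by rewrite /cyclic_proj; case: cid => w []. Qed.

(** The difference of two decompositions of [u] lies in the closed subspace and is orthogonal to it.
    Linearity of the projection and its commuting with [A] are read off from this. *)
Lemma cyclic_proj_uniq u w : in_cyclic w -> orth_cyclic (fun i => u i - w i) ->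
  cyclic_proj u = w.
Proof.
move=> iw ow; apply/funext => i; apply/eqP; rewrite -subr_eq0 -scaleN1r; apply/eqP.
apply: (@in_orth_cyclic_eq0 (fun i => cyclic_proj u i + (-1) *: w i)).
  by apply: in_cyclicD; [exact: cyclic_proj_in|exact: in_cyclicZ].
have -> : (fun i => cyclic_proj u i + (-1) *: w i)
    = (fun i => (u i - w i) + (-1) *: (u i - cyclic_proj u i)).
  by apply/funext => j; rewrite !scaleN1r opprB [RHS]addrC subrKA.
by apply: orth_cyclicD => //; apply: orth_cyclicZ; exact: cyclic_proj_orth.
Qed.

Lemma cyclic_projD u v :
  cyclic_proj (fun i => u i + v i) = (fun i => cyclic_proj u i + cyclic_proj v i).
Proof.
apply: cyclic_proj_uniq; first by apply: in_cyclicD; exact: cyclic_proj_in.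
have := orth_cyclicD (cyclic_proj_orth u) (cyclic_proj_orth v).
by congr orth_cyclic; apply/funext => i; rewrite opprD addrACA.
Qed.

Lemma cyclic_projZ (a : R[i]) u :
  cyclic_proj (fun i => a *: u i) = (fun i => a *: cyclic_proj u i).
Proof.
apply: cyclic_proj_uniq; first by apply: in_cyclicZ; exact: cyclic_proj_in.
have := orth_cyclicZ a (cyclic_proj_orth u).
by congr orth_cyclic; apply/funext => i; rewrite scalerBr.
Qed.

Lemma cyclic_projM b u : A b ->
  cyclic_proj (fun i => b (u i)) = (fun i => b (cyclic_proj u i)).
Proof.
move=> Ab; apply: cyclic_proj_uniq; first by apply: in_cyclicM => //; exact: cyclic_proj_in.
have := orth_cyclicM Ab (cyclic_proj_orth u).
by congr orth_cyclic; apply/funext => i; rewrite (bounded_opB (bdd Ab)).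
Qed.

Lemma cyclic_proj_id u : in_cyclic u -> cyclic_proj u = u.
Proof.
move=> iu; apply: cyclic_proj_uniq => // b Ab.
by rewrite sdotBl subrr.
Qed.

Lemma cyclic_proj_le u : sdot (cyclic_proj u) (cyclic_proj u) <= sdot u u.
Proof.
have := in_orth_cyclic (cyclic_proj_orth u) (cyclic_proj_in u).
have := sdot_ge0 (fun i => u i - cyclic_proj u i).
by rewrite !sdotBl !sdotBr (sdotC u (cyclic_proj u)); lra.
Qed.

Lemma cyclic_proj_sum (F : 'I_n -> 'I_n -> G) i :
  cyclic_proj (fun i => \sum_(j < n) F j i) i = \sum_(j < n) cyclic_proj (F j) i.
Proof.
elim: index_enum i => [|j r IH] i.
  under eq_fun do rewrite big_nil.
  rewrite big_nil; apply: (congr1 (fun f => f i) (_ : _ = fun=> 0)).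
  apply: cyclic_proj_id => e e0; exists 0; first exact: sa0.
  by move=> k; rewrite subrr rnorm0.
under eq_fun do rewrite big_cons.
by rewrite cyclic_projD IH big_cons.
Qed.

(** The (i, j) entry of the projection, viewed as a matrix of operators on G. *)
Definition cyclic_entry (i j : 'I_n) (h : G) : G :=
  cyclic_proj (fun l => if l == j then h else 0) i.

Lemma cyclic_entry_sum u i : cyclic_proj u i = \sum_(j < n) cyclic_entry i j (u j).
Proof.
rewrite -(cyclic_proj_sum (fun j l => if l == j then u j else 0)).
congr (cyclic_proj _ i); apply/funext => l.
by rewrite -big_mkcond (big_pred1 l)// => j; rewrite eq_sym.
Qed.

(** The projection commutes with the diagonal action of [A], hence each of its entries commutes with
    [A]. *)
Lemma cyclic_entry_commutant i j : commutant A (cyclic_entry i j).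
Proof.
apply/commutantP; split.
  apply/bounded_opP; split.
    move=> a u v; rewrite /cyclic_entry.
    transitivity (cyclic_proj (fun l => a *: (if l == j then u else 0) +
                                        (if l == j then v else 0)) i); last first.
      by rewrite cyclic_projD cyclic_projZ.
    congr (cyclic_proj _ i); apply/funext => l; case: eqP => // _.
    by rewrite scaler0 addr0.
  exists 1 => // v; rewrite mul1r -(ler_pXn2r (ltn0Sn 1)) ?nnegrE ?rnorm_ge0//.
  rewrite (le_trans (sdot_coord _ i))// (le_trans (cyclic_proj_le _))//.
  rewrite /sdot (bigD1 j)//= eqxx rdot_norm big1 ?addr0// => l /negPf ->.
  exact: rdot0l.
move=> b Ab g; rewrite /cyclic_entry.
transitivity (cyclic_proj (fun l => b (if l == j then g else 0)) i).
  by rewrite cyclic_projM.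
congr (cyclic_proj _ i); apply/funext => l; case: eqP => // _.
exact: bounded_op0 (bdd Ab).
Qed.

(** Replaces the use of an identity in [A]: with P the projection, b (gs - P gs) = b gs - P (b gs) =
    0 for all b in [A], so gs - P gs vanishes by non-degeneracy. *)
Lemma nondegenerate_in_cyclic : acts_nondegenerately A -> in_cyclic gs.
Proof.
move=> nA; suff -> : gs = cyclic_proj gs by exact: cyclic_proj_in.
apply/funext => i; apply/eqP; rewrite -subr_eq0; apply/eqP.
apply: (nondegenerate_eq0 sA nA) => b Ab.
rewrite (bounded_opB (bdd Ab)); have := cyclic_projM gs Ab.
rewrite cyclic_proj_id => [/(congr1 (fun f => f i)) <-|e e0]; first exact: subrr.
by exists b => // k; rewrite subrr rnorm0.
Qed.

End CyclicProjection.

(** Von Neumann's density argument: T commutes with the entries of the projection onto the cyclic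
    subspace of [gs], so its diagonal action preserves that subspace, which contains [gs]. *)
Lemma bicommutant_approx A T : star_algebra A -> acts_nondegenerately A ->
  commutant (commutant A) T -> forall n (gs : 'I_n -> G),
  in_cyclic (A := A) gs (fun i => T (gs i)).
Proof.
move=> sA nA /commutantP[bT hT] n gs.
suff -> : (fun i => T (gs i)) = cyclic_proj sA gs (fun i => T (gs i)).
  exact: cyclic_proj_in.
apply/funext => i.
rewrite -[in LHS](cyclic_proj_id sA (nondegenerate_in_cyclic sA gs nA)).
rewrite !cyclic_entry_sum (bounded_op_sum bT); apply: eq_bigr => j _.
by rewrite hT//; exact: cyclic_entry_commutant.
Qed.

Lemma bicommutant B T : von_neumann_algebra B -> acts_nondegenerately B ->
  commutant (commutant B) T -> B T.
Proof.
move=> vB nB hT; apply: (vna_closed vB); first by case: hT.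
move=> n g e e0; have sB := von_neumann_star_algebra vB.
have [b Bb hb] := bicommutant_approx sB nB hT g e0.
by exists b => // i; rewrite rnormE ltcR.
Qed.

Lemma von_neumann_id B : von_neumann_algebra B -> acts_nondegenerately B -> B id.
Proof.
move=> vB nB; apply: bicommutant => //; apply/commutantP; split => //.
exact: bounded_id.
Qed.

Lemma cyclic_projection A (g : G) : star_algebra A -> A id ->
  exists P, [/\ commutant A P, P g = g, forall h, P (P h) = P h,
    forall u v, rdot u (P v) = rdot (P u) v &
    forall h e, 0 < e -> exists2 b, A b & rnorm (P h - b g) < e].
Proof.
move=> sA A1; pose gs : 'I_1 -> G := fun=> g.
pose P h := cyclic_proj sA gs (fun=> h) ord0.
have PE h : cyclic_proj sA gs (fun=> h) = fun=> P h.
  by apply/funext => i; rewrite (ord1 i).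
have P_comm : commutant A P.
  suff -> : P = cyclic_entry sA gs ord0 ord0 by exact: cyclic_entry_commutant.
  by apply/funext => h; rewrite /P cyclic_entry_sum big_ord1.
have iP h : in_cyclic (A := A) gs (fun=> P h) by rewrite -PE; exact: cyclic_proj_in.
have oP h : orth_cyclic (A := A) gs (fun=> h - P h).
  by have := cyclic_proj_orth sA gs (fun=> h); rewrite PE.
exists P; split => //.
- rewrite /P cyclic_proj_id// => e e0; exists id => // i.
  by rewrite subrr rnorm0.
- by move=> h; rewrite {1}/P cyclic_proj_id.
- move=> u v; have := in_orth_cyclic (oP u) (iP v); have := in_orth_cyclic (oP v) (iP u).
  by rewrite /sdot !big_ord1 !rdotBl (rdotC v) (rdotC (P v)); lra.
- by move=> h e e0; have [b Ab hb] := iP h e e0; exists b => //; exact: (hb ord0).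
Qed.

End StarAlgebras.

(** * Approximate square roots and Paschke's inequality *)

Section OperatorNorm.
Context {R : realType} {V W : normedModType R[i]}.

Lemma opnorm_le (T : V -> W) (c : R) : 0 <= c ->
  (forall v, rnorm (T v) <= c * rnorm v) -> opnorm T <= c.
Proof.
move=> c0 hc; apply: ge_sup.
  by exists (complex.Re `|T 0|), 0 => //=; rewrite normr0.
move=> _ [v /= v1 <-]; apply: le_trans (hc v) _.
by rewrite ler_piMr// -lecR -rnormE.
Qed.

Lemma opnorm_bound (T : V -> W) : bounded_op T ->
  forall v, rnorm (T v) <= opnorm T * rnorm v.
Proof.
move=> bT v; have [c c0 hc] := bounded_op_bound bT.
have [v0|v0] := eqVneq (rnorm v) 0.
  by rewrite (rnorm_eq0 v0) (bounded_op0 bT) !rnorm0 mulr0.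
have vgt0 : 0 < rnorm v by rewrite lt_def v0 rnorm_ge0.
have vV : 0 <= (rnorm v)^-1 by rewrite invr_ge0 ltW.
rewrite -ler_pdivrMr// mulrC -rnormZr// -(bounded_opZ bT).
apply: ub_le_sup.
  exists c => _ [u /= u1 <-]; apply: le_trans (hc u) _.
  by rewrite ler_piMr// -lecR -rnormE.
exists ((rnorm v)^-1%:C *: v) => //=.
by rewrite rnormE rnormZr// mulVf.
Qed.

End OperatorNorm.

Section ApproximateRoots.
Context {R : realType} {G : hilbertType R}.
Variables (A : set (G -> G)) (sA : star_algebra A).

Definition self_adjoint (k : G -> G) := forall u v, rdot u (k v) = rdot (k u) v.

(* The iteration s := (k + s^2) / 2 contracts to a fixed point, for which
   (1 - s)^2 = 1 - k. *)
Lemma approx_sqrt (k : G -> G) (q0 : R) : A k -> self_adjoint k ->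
  0 <= q0 < 1 -> (forall g, rnorm (k g) <= q0 * rnorm g) ->
  exists2 q, 0 <= q < 1 & forall e, 0 < e -> exists s, [/\ A s, self_adjoint s,
    forall g, rnorm (s g) <= q * rnorm g &
    forall g, rnorm (k g + s (s g) - 2%:C *: s g) <= e * rnorm g].
Proof.
(* With q0 = 2 q - 1 one has (q0 + q^2) / 2 <= q, so the iteration preserves the norm bound [q]. *)
move=> Ak ka /andP[q00 q01] hk; pose q := (1 + q0) / 2.
have q_0 : 0 <= q by rewrite /q; lra.
have q_1 : q < 1 by rewrite /q; lra.
exists q => [|e e0]; first by rewrite q_0.
have bk := sa_bounded sA Ak.
have iter m : exists s, [/\ A s, self_adjoint s,
    forall g, rnorm (s g) <= q * rnorm g &
    forall g, rnorm ((2^-1)%:C *: (k g + s (s g)) - s g) <= q ^+ m * rnorm g].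
  elim: m => [|m [s [As sa sq sm]]].
    exists 0; split; first exact: sa0.
    - by move=> u v; rewrite rdot0r rdot0l.
    - by move=> g; rewrite -[leLHS]/(rnorm (0 : G)) rnorm0 mulr_ge0 ?rnorm_ge0.
    - move=> g; rewrite -[X in rnorm X]/((2^-1)%:C *: (k g + 0) - 0) subr0 addr0 rnormZr// expr0.
      have := hk g; have := rnorm_ge0 g; have := rnorm_ge0 (k g).
      have : q0 * rnorm g <= 1 * rnorm g by rewrite ler_wpM2r ?rnorm_ge0// ltW.
      lra.
  have bs := sa_bounded sA As.
  exists ((2^-1)%:C *: (k + (s \o s))).
  have s'E g : ((2^-1)%:C *: (k + (s \o s))) g = (2^-1)%:C *: (k g + s (s g)) by rewrite !fctE.
  have As' : A ((2^-1)%:C *: (k + (s \o s))).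
    by apply: saZ => //; apply: saD => //; exact: saM.
  have s'q g : rnorm (((2^-1)%:C *: (k + (s \o s))) g) <= q * rnorm g.
    rewrite s'E rnormZr// mulrC ler_pdivrMr//.
    have h1 := hk g; have h2 := sq (s g).
    have h3 : q * rnorm (s g) <= q * (q * rnorm g) by rewrite ler_wpM2l.
    have h4 : (q0 + q * q) * rnorm g <= (q * 2) * rnorm g.
      by rewrite ler_wpM2r ?rnorm_ge0// /q; nra.
    have := rnormD (k g) (s (s g)); lra.
  split => //.
    move=> u v; rewrite !s'E rdotZr rdotZl rdotDr rdotDl ka sa.
    by rewrite (sa (s u)) -sa.
  move: As' s'q s'E; set s' := (2^-1)%:C *: _ => As' s'q s'E g.
  have bs' := sa_bounded sA As'.
  (* s'^2 - s^2 = s' (s' - s) + (s' - s) s: each summand gains a factor [q], and the halving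
     compensates for there being two. *)
  have -> : (2^-1)%:C *: (k g + s' (s' g)) - s' g
      = (2^-1)%:C *: (s' (s' g - s g) + (s' (s g) - s (s g))).
    by rewrite [X in _ - X]s'E -scalerBr (bounded_opB bs') subrKA opprD addrACA subrr add0r.
  rewrite rnormZr// exprS.
  have h1 := sm g; rewrite -s'E in h1.
  have h2 := sm (s g); rewrite -s'E in h2.
  have h3 := s'q (s' g - s g).
  have h4 : q * rnorm (s' g - s g) <= q * (q ^+ m * rnorm g) by rewrite ler_wpM2l.
  have h5 : q ^+ m * rnorm (s g) <= q ^+ m * (q * rnorm g).
    by rewrite ler_wpM2l ?exprn_ge0.
  have := rnormD (s' (s' g - s g)) (s' (s g) - s (s g)); lra.
have [||m hm] := @expr_small _ q (e / 2); first by rewrite q_0.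
  by rewrite divr_gt0.
have [s [As sa sq sm]] := iter m; exists s; split => // g.
have -> : k g + s (s g) - 2%:C *: s g
    = 2%:C *: ((2^-1)%:C *: (k g + s (s g)) - s g).
  by rewrite scalerBr scalerA -rmorphM/= mulfV ?scale1r// pnatr_eq0.
rewrite rnormZr//; have := sm g.
have : q ^+ m * rnorm g <= e / 2 * rnorm g by rewrite ler_wpM2r ?rnorm_ge0// ltW.
lra.
Qed.

(** Partial sums of the Neumann series of 1 / (1 - s): the step b := 1 + s b multiplies the errors
    (1 - s) b - 1 and b (1 - s) - 1 by s on the left. *)
Lemma approx_inverse (A1 : A id) (s : G -> G) (q : R) : A s -> 0 <= q ->
  (forall g, rnorm (s g) <= q * rnorm g) ->
  forall m, exists b, [/\ A b,
    forall g, rnorm (b g - s (b g) - g) <= q ^+ m * rnorm g &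
    forall g, rnorm (b (g - s g) - g) <= q ^+ m * rnorm g].
Proof.
move=> As q0 hs; have bs := sa_bounded sA As; elim=> [|m [b [Ab h1 h2]]].
  exists 0; split; first exact: sa0.
    by move=> g; rewrite (bounded_op0 bs) subr0 sub0r rnormN expr0 mul1r.
  by move=> g; rewrite sub0r rnormN expr0 mul1r.
exists (id + (s \o b)); split.
- by apply: saD => //; exact: saM.
- move=> g; have -> : (id + (s \o b)) g - s ((id + (s \o b)) g) - g
      = s (b g - s (b g) - g).
    rewrite !fctE /= (bounded_opD bs) !(bounded_opB bs).
    by rewrite addrAC [g + _]addrC addrK opprD addrA addrAC.
  by rewrite (le_trans (hs _))// exprS -mulrA ler_wpM2l.
- move=> g; have -> : (id + (s \o b)) (g - s g) - g = s (b (g - s g) - g).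
    rewrite !fctE /= (bounded_opB bs).
    by rewrite addrAC [g - _ - g]addrAC subrr sub0r addrC.
  by rewrite (le_trans (hs _))// exprS -mulrA ler_wpM2l.
Qed.

(* Paschke's inequality: with b close to the inverse of the square root h of
   x^* x + e, the operator x b is almost contractive, and T g is close to
   T (b (h g)). *)
Lemma paschke_inequality (A1 : A id) (H : hilbertType R) (x : G -> H)
    (T : G -> G) (c : R) : bounded_op x -> A (adjoint x \o x) -> bounded_op T ->
  0 <= c ->
  (forall b beta, A b -> 0 <= beta ->
     (forall g, rnorm (x (b g)) <= beta * rnorm g) ->
     forall g, rnorm (T (b g)) <= c * beta * rnorm g) ->
  forall g, rnorm (T g) <= c * rnorm (x g).
Proof.
move=> bx Aa bT c0 hT g.
have [K K0 hK] := bounded_op_bound bx; have hK' := adjoint_bound bx K0 hK.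
have [t t0 ht] := bounded_op_bound bT.
rewrite -(ler_pXn2r (ltn0Sn 1)) ?nnegrE ?mulr_ge0 ?rnorm_ge0//.
apply: (@le_of_eps _ _ _ (2 * c ^+ 2 * rnorm g ^+ 2)) => e e0.
(* The operator [k] below is 1 - (x^* x + e) / l, so 1 - s approximates the square root of (x^* x +
   e) / l. This [l] gives |k| <= mu < 1. *)
pose l := K ^+ 2 + 2 * e; pose mu := 1 - e / l.
have l0 : 0 < l by rewrite /l; have := sqr_ge0 K; lra.
have le : 0 < e / l by rewrite divr_gt0.
have le1 : e / l < 1 by rewrite ltr_pdivrMr// /l; have := sqr_ge0 K; lra.
have lV : 0 < l^-1 by rewrite invr_gt0.
pose k : G -> G := mu%:C *: id + (- l^-1)%:C *: (adjoint x \o x).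
have kE u : k u = mu%:C *: u + (- l^-1)%:C *: adjoint x (x u) by rewrite /k !fctE.
have xx u v : rdot u (adjoint x (x v)) = rdot (x u) (x v).
  by rewrite rdotC -radjointP// rdotC.
have Ak : A k by apply: saD => //; apply: saZ.
have ka : self_adjoint k.
  move=> u v; rewrite !kE rdotDr rdotDl !rdotZr !rdotZl xx.
  by rewrite (rdotC (adjoint _ _)) xx (rdotC (x v)).
have gk u : rdot u (k u) = mu * rnorm u ^+ 2 - l^-1 * rnorm (x u) ^+ 2.
  by rewrite kE rdotDr !rdotZr xx !rdot_norm mulNr.
have hk u : rnorm (k u) <= mu * rnorm u.
  rewrite -(ler_pXn2r (ltn0Sn 1)) ?nnegrE ?mulr_ge0 ?rnorm_ge0//; last by rewrite /mu; lra.
  rewrite -rdot_norm kE rdotDl !rdotDr !rdotZl !rdotZr xx (rdotC (adjoint _ _) u) xx.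
  rewrite !rdot_norm; have h1 := hK' (x u).
  have h2 : rnorm (adjoint x (x u)) ^+ 2 <= K ^+ 2 * rnorm (x u) ^+ 2.
    by rewrite -exprMn ler_pXn2r ?nnegrE ?mulr_ge0 ?rnorm_ge0.
  have h3 : l^-1 * rnorm (adjoint x (x u)) ^+ 2 <= (2 * mu) * rnorm (x u) ^+ 2.
    rewrite mulrC ler_pdivrMr// (le_trans h2)// [leRHS]mulrAC ler_wpM2r ?sqr_ge0//.
    rewrite /mu -mulrA mulrBl mul1r divfK ?gt_eqF// /l; have := sqr_ge0 K; lra.
  have := ler_wpM2l (ltW lV) h3; rewrite exprMn; lra.
have [|q /andP[q0 q1] root] := @approx_sqrt k mu Ak ka _ hk.
  by rewrite /mu; apply/andP; split; lra.
have [s [As sa sq serr]] := root _ le; have bs := sa_bounded sA As.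
pose h u := u - s u.
have hh u : l * rnorm (h u) ^+ 2 - (rnorm (x u) ^+ 2 + e * rnorm u ^+ 2)
    = l * rdot u (k u + s (s u) - 2%:C *: s u).
  rewrite -[X in l * X]rdot_norm /h rdotBl !rdotBr (rdotC (s u) u) -sa rdotDr.
  rewrite rdotZr gk rdot_norm /mu; field; lra.
have err u : `|l * rdot u (k u + s (s u) - 2%:C *: s u)| <= e * rnorm u ^+ 2.
  rewrite normrM gtr0_norm//.
  apply: (@le_trans _ _ (l * (rnorm u * (e / l * rnorm u)))).
    by rewrite ler_wpM2l ?(ltW l0)// (le_trans (rdot_norm_le _ _))// ler_wpM2l ?rnorm_ge0.
  by rewrite le_eqVlt; apply/orP; left; apply/eqP; field; lra.
(* The root was taken with tolerance e / l, so its error is at most e |u|^2 and is absorbed by the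
   shift of x^* x by e. Hence [lower] carries no error term. *)
have lower u : rnorm (x u) ^+ 2 <= l * rnorm (h u) ^+ 2.
  by have := err u; rewrite -hh ler_norml => /andP[]; lra.
have upper u : l * rnorm (h u) ^+ 2 <= rnorm (x u) ^+ 2 + 2 * e * rnorm u ^+ 2.
  by have := err u; rewrite -hh ler_norml => /andP[]; lra.
pose r := Num.sqrt l.
have r0 : 0 <= r by exact: sqrtr_ge0.
have rr : r ^+ 2 = l by rewrite sqr_sqrtr// ltW.
have lower' u : rnorm (x u) <= r * rnorm (h u).
  rewrite -(ler_pXn2r (ltn0Sn 1)) ?nnegrE ?mulr_ge0 ?rnorm_ge0//.
  by rewrite exprMn rr.
(* Only the error [d] of the inverse tends to 0 here; [e], and with it [h] and [r], stays fixed. *)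
have Th : rnorm (T g) <= c * r * rnorm (h g).
  apply: (@le_of_eps _ _ _ (c * r * rnorm (h g) + t * rnorm g)) => d d0.
  have [||m hm] := @expr_small _ q d => //; first by rewrite q0.
  have [b [Ab b1 b2]] := approx_inverse A1 As q0 sq m.
  have qm : 0 <= q ^+ m by rewrite exprn_ge0.
  have xb u : rnorm (x (b u)) <= r * (1 + d) * rnorm u.
    rewrite (le_trans (lower' _))// -mulrA ler_wpM2l// /h.
    have := rdist_triangle (R := R) (V := G) u (b u - s (b u)) 0.
    rewrite !subr0 => h1; apply: le_trans h1 _; have := b1 u.
    have : q ^+ m * rnorm u <= d * rnorm u by rewrite ler_wpM2r ?rnorm_ge0// ltW.
    lra.
  have Tb := hT b (r * (1 + d)) Ab _ xb (h g).
  have Tg : rnorm (T g) <= rnorm (T (b (h g))) + t * (d * rnorm g).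
    have -> : T g = T (b (h g)) - T (b (h g) - g) by rewrite -(bounded_opB bT) subKr.
    rewrite (le_trans (rnormB _ _))// lerD2l (le_trans (ht _))// ler_wpM2l//.
    by rewrite (le_trans (b2 g))// ler_wpM2r ?rnorm_ge0// ltW.
  apply: le_trans Tg _; have := Tb _; rewrite mulr_ge0//; last by lra.
  by move=> /(_ isT); lra.
have : rnorm (T g) ^+ 2 <= c ^+ 2 * (l * rnorm (h g) ^+ 2).
  rewrite -rr -!exprMn mulrA.
  by rewrite ler_pXn2r ?nnegrE ?mulr_ge0 ?rnorm_ge0.
move=> /le_trans; apply; rewrite exprMn.
apply: le_trans (ler_wpM2l (sqr_ge0 c) (upper g)) _.
by rewrite mulrDr; lra.
Qed.

End ApproximateRoots.

(** * Extension of densely defined maps *)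

Section Extension.
Context {R : realType}.

Section LinearRelation.
Context {V : normedModType R[i]} {W : completeNormedModType R[i]}.
Variables (F : V -> W -> Prop) (c : R).
Hypothesis c0 : 0 <= c.
Hypothesis F_linear : forall (a : R[i]) u v w z,
  F u w -> F v z -> F (a *: u + v) (a *: w + z).
Hypothesis F_bound : forall u w, F u w -> rnorm w <= c * rnorm u.
Hypothesis F_dense : forall v e, 0 < e -> exists u w, F u w /\ rnorm (v - u) < e.

(** The closure of the graph [F] in the product of V and W. *)
Let F_closure v z := forall e : R, 0 < e ->
  exists u w, [/\ F u w, rnorm (v - u) < e & rnorm (z - w) < e].

Let F_closure_exists v : exists z, F_closure v z.
Proof.
have step (m : nat) : exists uw : V * W, F uw.1 uw.2 /\ rnorm (v - uw.1) < 2^-1 ^+ m.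
  have m0 : (0 : R) < 2^-1 ^+ m by rewrite exprn_gt0// invr_gt0.
  by have [u [w [Fuw vu]]] := F_dense v m0; exists (u, w).
have [uw /all_and2[Fuw vu]] := choice step.
have half m m0 : (m0 <= m)%N -> (2^-1 : R) ^+ m <= 2^-1 ^+ m0.
  by move=> h; rewrite ler_wiXn2l// ?invr_ge0// invf_le1// ler1n.
have small e : 0 < e -> exists n0, (2^-1 : R) ^+ n0 < e.
  by move=> e0; apply: expr_small => //; rewrite invr_ge0 ler0n invf_lt1// ltr1n.
have c1 : 0 < c + 1 by rewrite ltr_wpDl.
have [|z zP] := @complete_rnorm R W (fun m => (uw m).2).
  move=> e e0; have [|n0 hn0] := small (e / (c + 1) / 2).
    by rewrite !divr_gt0.
  exists n0 => m m' hm hm'; rewrite addrC -scaleN1r.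
  apply: le_lt_trans (F_bound (F_linear (-1) (Fuw m') (Fuw m))) _.
  rewrite scaleN1r addrC.
  have d : rnorm ((uw m).1 - (uw m').1) <= e / (c + 1).
    apply: le_trans (rdist_triangle v _ _) _; rewrite (rdistC _ v).
    have := vu m; have := vu m'; have := half _ _ hm; have := half _ _ hm'; lra.
  apply: le_lt_trans (ler_wpM2l c0 d) _.
  by rewrite mulrCA -[ltRHS]mulr1 ltr_pM2l// ltr_pdivrMr// mul1r; lra.
exists z => e e0; have [n0 hn0] := zP _ e0; have [n1 hn1] := small _ e0.
exists (uw (maxn n0 n1)).1, (uw (maxn n0 n1)).2; split => //.
  by rewrite (lt_trans (vu _))// (le_lt_trans _ hn1)// half// leq_maxr.
by apply: hn0; exact: leq_maxl.
Qed.

Let F_closure_linear (a : R[i]) u v w z :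
  F_closure u w -> F_closure v z -> F_closure (a *: u + v) (a *: w + z).
Proof.
move=> huw hvz e e0; set k := complex.Re `|a|.
have k0 : 0 <= k by rewrite -lecR RRe_real ?ger0_real ?normr_ge0//; exact: normr_ge0.
have k1 : 0 < k + 1 by lra.
have d0 : 0 < e / (k + 1) by rewrite divr_gt0.
have dE : (k + 1) * (e / (k + 1)) = e by field; lra.
have [u' [w' [F1 uu ww]]] := huw _ d0; have [v' [z' [F2 vv zz]]] := hvz _ d0.
have near (U : normedModType R[i]) (p p' q q' : U) : rnorm (p - p') < e / (k + 1) ->
    rnorm (q - q') < e / (k + 1) -> rnorm (a *: p + q - (a *: p' + q')) < e.
  move=> hp hq; rewrite opprD addrACA -scalerBr (le_lt_trans (rnormD _ _))//.
  rewrite rnormZ -/k; have := ler_wpM2l k0 (ltW hp); lra.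
by exists (a *: u' + v'), (a *: w' + z'); split; [exact: F_linear|exact: near|exact: near].
Qed.

Let F_closure_bound v z : F_closure v z -> rnorm z <= c * rnorm v.
Proof.
move=> h; apply: (@le_of_eps _ _ _ (1 + c)) => e e0.
have [u [w [Fuw vu zw]]] := h _ e0.
have h1 : rnorm z <= rnorm (z - w) + rnorm w by rewrite -{1}(subrK w z) rnormD.
have h2 : rnorm u <= rnorm (v - u) + rnorm v by rewrite rdistC -{1}(subrK v u) rnormD.
have := F_bound Fuw; have := ler_wpM2l c0 h2; have := ler_wpM2l c0 (ltW vu); lra.
Qed.

(** The closed graph is total by density and completeness. It is single-valued because the bound,
    applied to the pair (0, z - z'), forces z = z'. *)
Lemma extend_linear_relation :
  exists2 S : V -> W, bounded_op S & forall u w, F u w -> S u = w.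
Proof.
have [S hS] := choice F_closure_exists.
have uniq v z z' : F_closure v z -> F_closure v z' -> z = z'.
  move=> h h'; apply/eqP; rewrite -subr_eq0; apply/eqP/rnorm_eq0/eqP.
  rewrite eq_le rnorm_ge0 andbT.
  have := F_closure_bound (F_closure_linear (-1) h' h).
  by rewrite !scaleN1r addNr rnorm0 mulr0 addrC.
exists S => [|u w Fuw].
  apply/bounded_opP; split.
    by move=> a u v; apply: uniq (hS _) _; exact: F_closure_linear.
  by exists c => // v; exact: F_closure_bound.
apply: uniq (hS _) _ => e e0; exists u, w.
by rewrite !subrr !rnorm0.
Qed.

End LinearRelation.

Lemma lspan_sub (V : normedModType R[i]) (S T : set V) :
  S `<=` T -> dense (lspan S) -> dense (lspan T).
Proof.
move=> ST dS O O0 oO; have [v [Ov [n [a [w [Sw vE]]]]]] := dS O O0 oO.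
by exists v; split => //; exists n, a, w; split => // i; exact: ST.
Qed.

Lemma bounded_op_ext (V W : normedModType R[i]) (S : set V) (T1 T2 : V -> W) :
  dense (lspan S) -> bounded_op T1 -> bounded_op T2 ->
  (forall v, S v -> T1 v = T2 v) -> T1 = T2.
Proof.
move=> dS b1 b2 T12; apply/funext => v; apply/eqP; rewrite -subr_eq0; apply/eqP.
have bB : bounded_op (T1 + (-1) *: T2) by apply: bounded_add => //; exact: bounded_scale.
have BE u : (T1 + (-1) *: T2) u = T1 u - T2 u by rewrite !fctE scaleN1r.
rewrite -BE; apply: (bounded_op_eq0 bB dS) => _ [n [a [w [Sw ->]]]].
rewrite BE (bounded_op_sum b1) (bounded_op_sum b2) -sumrB big1// => i _.
by rewrite (bounded_opZ b1) (bounded_opZ b2) T12// subrr.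
Qed.

(** The inequality on sums also contains well-definedness. Scalars are absorbed into the vector
    argument, so plain sums already fill the span. *)
Lemma extend_tensor_map (X : Type) (G : normedModType R[i])
    (H : normedModType R[i]) (K : completeNormedModType R[i])
    (F : X -> G -> H) (Psi : X -> G -> K) (c : R) :
  (forall x, bounded_op (F x)) -> (forall x, bounded_op (Psi x)) ->
  dense (lspan [set h | exists x g, h = F x g]) -> 0 <= c ->
  (forall s : seq (X * G), rnorm (\sum_(p <- s) Psi p.1 p.2)
      <= c * rnorm (\sum_(p <- s) F p.1 p.2)) ->
  exists2 S : H -> K, bounded_op S & forall x g, S (F x g) = Psi x g.
Proof.
move=> bF bPsi /denseP dF c0 hc.
pose rel h k := exists s : seq (X * G),
  h = \sum_(p <- s) F p.1 p.2 /\ k = \sum_(p <- s) Psi p.1 p.2.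
have [||||S bS hS] := @extend_linear_relation H K rel c => //.
- move=> a u v w z [s [-> ->]] [s' [-> ->]].
  exists ([seq (p.1, a *: p.2) | p <- s] ++ s').
  rewrite !big_cat !big_map /= !scaler_sumr; split; congr (_ + _).
    by apply: eq_bigr => p _; rewrite (bounded_opZ (bF _)).
  by apply: eq_bigr => p _; rewrite (bounded_opZ (bPsi _)).
- by move=> u w [s [-> ->]].
- move=> v e e0; have [_ [n [a [w [Sw ->]]]] ve] := dF v _ e0.
  have /choice[xg wE] : forall i, exists xg : X * G, w i = F xg.1 xg.2.
    by move=> i; have [x [g ->]] := Sw i; exists (x, g).
  pose s := [seq ((xg i).1, a i *: (xg i).2) | i <- index_enum 'I_n].
  exists (\sum_(p <- s) F p.1 p.2), (\sum_(p <- s) Psi p.1 p.2).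
  split; first by exists s.
  rewrite /s big_map /=; suff -> : \sum_(i < n) F (xg i).1 (a i *: (xg i).2)
    = \sum_(i < n) a i *: w i by [].
  by apply: eq_bigr => i _; rewrite (bounded_opZ (bF _)) wE.
exists S => // x g; apply: hS; exists [:: (x, g)].
by rewrite !big_seq1.
Qed.

End Extension.

(** * From single vectors to sums of vectors *)

Section Domination.
Context {R : realType} {G : hilbertType R}.

Lemma rdot_big0 (V : hilbertType R) (I : Type) (s : seq I) (v : V) (f : I -> V) :
  (forall i, rdot v (f i) = 0) -> rdot v (\sum_(i <- s) f i) = 0.
Proof.
move=> h; elim/big_rec: _ => [|i w _ hw]; first exact: rdot0r.
by rewrite rdotDr h hw addr0.
Qed.

Lemma pythagoras (V : hilbertType R) (u v : V) :
  rdot u v = 0 -> rnorm (u + v) ^+ 2 = rnorm u ^+ 2 + rnorm v ^+ 2.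
Proof.
by move=> h; rewrite -!rdot_norm rdotDl !rdotDr (rdotC v u) h add0r addr0.
Qed.

Variables (A : set (G -> G)) (sA : star_algebra A) (A1 : A id).
Variables (H K : hilbertType R) (X : Type) (F : X -> G -> H) (Psi : X -> G -> K).
Variable c : R.
Hypothesis c0 : 0 <= c.
Hypothesis bF : forall x, bounded_op (F x).
Hypothesis bPsi : forall x, bounded_op (Psi x).
Hypothesis FF : forall x y, A (adjoint (F x) \o F y).
Hypothesis PsiPsi : forall x y, A (adjoint (Psi x) \o Psi y).
Hypothesis axpy : forall x y b, A b -> exists z,
  (forall g, F z g = F x (b g) + F y g) /\ (forall g, Psi z g = Psi x (b g) + Psi y g).
Hypothesis PsiF : forall x g, rnorm (Psi x g) <= c * rnorm (F x g).

(* The pieces of the sum over P (f g) and (1 - P) (f g), P the projection onto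
   the closure of A g0 for the first vector g0, are orthogonal; the first one
   is approximately F z g0 and falls under PsiF, the second one has one term
   less. *)
Lemma sum_domination (s : seq (X * G)) (f : G -> G) :
  rnorm (\sum_(p <- s) Psi p.1 (f p.2)) <= c * rnorm (\sum_(p <- s) F p.1 (f p.2)).
Proof.
(* [f] is generalised because the induction hypothesis is used for [f] followed by 1 - P, where P
   depends on the first vector. *)
elim: s f => [|[x g] s IH] f; first by rewrite !big_nil !rnorm0 mulr0.
rewrite !big_cons /=; set g0 := f g.
have [P [/commutantP[bP AP] Pg PP Psa Pin]] := cyclic_projection g0 sA A1.
have split_sum (L : hilbertType R) (T : X -> G -> L) : (forall x, bounded_op (T x)) ->
    T x g0 + \sum_(p <- s) T p.1 (f p.2) =
    (T x g0 + \sum_(p <- s) T p.1 (P (f p.2))) +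
    \sum_(p <- s) T p.1 (f p.2 - P (f p.2)).
  move=> bT; rewrite -addrA -big_split; congr (_ + _); apply: eq_bigr => p _ /=.
  by rewrite -(bounded_opD (bT _)) addrC subrK.
have orth (L : hilbertType R) (T : X -> G -> L) : (forall x, bounded_op (T x)) ->
    (forall x y, A (adjoint (T x) \o T y)) ->
    rdot (T x g0 + \sum_(p <- s) T p.1 (P (f p.2)))
      (\sum_(p <- s) T p.1 (f p.2 - P (f p.2))) = 0.
  move=> bT TT.
  (* (T y)^* T z lies in [A] and commutes with P, and P (1 - P) = 0. *)
  have orth1 y z u v : rdot (T y (P u)) (T z (v - P v)) = 0.
    rewrite rdotC radjointP// rdotC -Psa.
    rewrite -[P (adjoint _ _)](AP _ (TT y z)) (bounded_opB bP) PP subrr /=.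
    rewrite (bounded_op0 (bT z)) bounded_op0 ?rdot0r//; exact: adjoint_bounded.
  apply: rdot_big0 => q; rewrite rdotDl -{1}Pg orth1 add0r rdotC.
  by apply: rdot_big0 => p; rewrite rdotC orth1.
(* Each P (f h) is replaced by a nearby b g0, and [axpy] merges the sum into one index z, the same
   for [F] and [Psi]. *)
have approx : exists C, forall e, 0 < e -> exists z,
    rnorm (F x g0 + \sum_(p <- s) F p.1 (P (f p.2)) - F z g0) <= e * C /\
    rnorm (Psi x g0 + \sum_(p <- s) Psi p.1 (P (f p.2)) - Psi z g0) <= e * C.
  elim: (s) => [|[y h] r [C hC]].
    by exists 0 => e e0; exists x; rewrite !big_nil !addr0 !subrr !rnorm0 mulr0.
  have [k k0 hk] := bounded_op_bound (bF y); have [l l0 hl] := bounded_op_bound (bPsi y).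
  exists (C + k + l) => e e0; have [z [zF zPsi]] := hC e e0.
  have [b Ab hb] := Pin (f h) e e0; have [w [wF wPsi]] := axpy y z Ab.
  exists w; rewrite !big_cons /= wF wPsi.
  have regroup (L : hilbertType R) (p q r' p' q' : L) :
      p + (q + r') - (p' + q') = (p + r' - q') + (q - p').
    by rewrite addrCA opprD addrACA addrC.
  rewrite !regroup -(bounded_opB (bF y)) -(bounded_opB (bPsi y)).
  have := hk (P (f h) - b g0); have := hl (P (f h) - b g0).
  have := ler_wpM2l k0 (ltW hb); have := ler_wpM2l l0 (ltW hb).
  have := mulr_ge0 (ltW e0) k0; have := mulr_ge0 (ltW e0) l0.
  by move=> *; split; apply: le_trans (rnormD _ _) _; lra.
rewrite (split_sum _ Psi)// (split_sum _ F)//.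
have oF := orth _ F bF FF; have oPsi := orth _ Psi bPsi PsiPsi.
(* Squares of orthogonal pieces add, so bounding each piece with constant [c] gives the sum with the
   same [c]. *)
rewrite -(ler_pXn2r (ltn0Sn 1)) ?nnegrE ?mulr_ge0 ?rnorm_ge0//.
rewrite exprMn (pythagoras oF) (pythagoras oPsi) mulrDr -!exprMn lerD//; last first.
  rewrite ler_pXn2r ?nnegrE ?mulr_ge0 ?rnorm_ge0//.
  exact: (IH (fun h => f h - P (f h))).
rewrite ler_pXn2r ?nnegrE ?mulr_ge0 ?rnorm_ge0//.
have [C hC] := approx; apply: (@le_of_eps _ _ _ (C + c * C)) => e e0.
have [z [zF zPsi]] := hC e e0; move: zF zPsi.
set VF := F x g0 + _; set VPsi := Psi x g0 + _ => zF zPsi.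
have h1 : rnorm VPsi <= rnorm (VPsi - Psi z g0) + rnorm (Psi z g0).
  by rewrite -{1}(subrK (Psi z g0) VPsi) rnormD.
have h2 : rnorm (F z g0) <= rnorm (VF - F z g0) + rnorm VF.
  by rewrite rdistC -{1}(subrK VF (F z g0)) rnormD.
have h3 := PsiF z g0; have := ler_wpM2l c0 h2; have := ler_wpM2l c0 zF; lra.
Qed.

End Domination.

(** * The module of intertwiners *)

Section Intertwiners.
Context {R : realType} {G : hilbertType R} {B : set (G -> G)}.
Context {E : hilbertModule B} {H : hilbertType R}.
Variables (vnB : von_neumann_algebra B) (ndB : acts_nondegenerately B).
Variables (t : E -> G -> H) (tensor_t : interior_tensor t).

Let sB := von_neumann_star_algebra vnB.
Let sB' := commutant_star_algebra sB.

(** The defect of linearity is orthogonal to all elementary tensors, which are total. *)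
Lemma tensor_bounded x : bounded_op (t x).
Proof.
have bip y z := sa_bounded sB (hm_ip_in (h := E) y z).
apply/bounded_opP; split=> [a u v|].
  apply/eqP; rewrite -subr_eq0; apply/eqP.
  apply: (dense_lspan_eq0 (itensor_dense tensor_t)) => _ [y [g ->]].
  rewrite hdotC opprD addrA -scaleN1r -[- t x v]scaleN1r.
  rewrite !hdotDr !hdotZr !(itensor_dot tensor_t) (bip y x).1 hdotDr hdotZr.
  by rewrite -[RHS]conjc0; congr conjc; ring.
have [c c0 hc] := bounded_op_bound (bip x x).
(* The natural constant is the square root of [c]; c <= (c + 1)^2 avoids it. *)
exists (c + 1) => [|g]; first by rewrite addr_ge0.
rewrite -(ler_pXn2r (ltn0Sn 1)) ?nnegrE ?mulr_ge0 ?rnorm_ge0 ?addr_ge0//.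
rewrite -rdot_norm /rdot (itensor_dot tensor_t) -/(rdot _ _).
apply: le_trans (rdot_le _ _) _; apply: (@le_trans _ _ (c * rnorm g ^+ 2)).
  by rewrite mulrC expr2 mulrA ler_wpM2r ?rnorm_ge0.
by rewrite exprMn ler_wpM2r ?sqr_ge0//; nra.
Qed.

(** Up to a small error, 1 - c^-2 b'^* b' equals h^* h with h in the commutant. Then <tau id, tau
    (h^* h)> = |tau h|^2 >= 0 is the desired inequality in the limit. *)
Lemma commutant_rep_le b' : commutant B b' ->
  exists2 c : R, 0 <= c & forall s : seq (E * G),
    rnorm (\sum_(p <- s) t p.1 (b' p.2)) <= c * rnorm (\sum_(p <- s) t p.1 p.2).
Proof.
move=> Bb'; have [bb' _] := Bb'; have [c0 c00 hc0] := bounded_op_bound bb'.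
(* Strictly above [c0], so that c^-2 b'^* b' has norm below 1, as the square root requires. *)
pose c := c0 + 1; have c1 : 0 < c by rewrite /c; lra.
exists c => [|s]; first exact: ltW.
pose tau (d : G -> G) := \sum_(p <- s) t p.1 (d p.2).
rewrite -[leLHS]/(rnorm (tau b')) -[X in _ * X]/(rnorm (tau id)).
(* Elements of the commutant move across the inner product because the values of [hm_ip] lie in
   [B]. *)
have tau_dot d e : commutant B d -> rdot (tau d) (tau e) = rdot (tau id) (tau (adjoint d \o e)).
  move=> Bd; have [bd _] := Bd.
  have /commutantP[_ dB] := sa_adjoint sB' Bd.
  rewrite /tau; elim: {1 3}s => [|p r IH]; first by rewrite !big_nil !rdot0l.
  rewrite !big_cons !rdotDl IH; congr (_ + _).
  elim: {1 2}s => [|q r' IH']; first by rewrite !big_nil !rdot0r.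
  rewrite !big_cons !rdotDr IH'; congr (_ + _).
  rewrite /rdot !(itensor_dot tensor_t) -!/(rdot _ _) rdotC radjointP// rdotC /=.
  by rewrite dB//; exact: hm_ip_in.
(* A crude bound whose [K] depends only on the list [s]; it makes the error of the square root
   negligible. *)
have [K tau_le] : exists K, forall d e, (forall g, rnorm (d g) <= e * rnorm g) ->
    rnorm (tau d) <= e * K.
  rewrite /tau; elim: (s) => [|p r [K hK]].
    by exists 0 => d e _; rewrite big_nil rnorm0 mulr0.
  have [k k0 hk] := bounded_op_bound (tensor_bounded p.1).
  exists (k * rnorm p.2 + K) => d e de; rewrite big_cons.
  apply: le_trans (rnormD _ _) _; have := hK _ _ de.
  have := hk (d p.2); have := ler_wpM2l k0 (de p.2); lra.
pose k : G -> G := (c ^- 2)%:C *: (adjoint b' \o b').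
have kE g : k g = (c ^- 2)%:C *: adjoint b' (b' g) by rewrite /k !fctE.
have cV : 0 < c ^- 2 by rewrite invr_gt0 exprn_gt0.
have Bk : commutant B k.
  by apply: (saZ sB'); apply: (saM sB') => //; exact: (sa_adjoint sB').
have kdot u v : rdot u (k v) = c ^- 2 * rdot (b' u) (b' v).
  by rewrite kE rdotZr rdotC -radjointP// rdotC.
have ka : self_adjoint k.
  by move=> u v; rewrite kdot (rdotC (k u)) kdot (rdotC (b' v)).
have [|g|q _ root] := approx_sqrt sB' Bk ka (q0 := c0 ^+ 2 / c ^+ 2).
- rewrite divr_ge0 ?sqr_ge0//= ltr_pdivrMr ?exprn_gt0// mul1r.
  by rewrite ltr_pXn2r ?nnegrE// /c; lra.
- rewrite kE rnormZr ?(ltW cV)// [c0 ^+ 2 / _]mulrC -mulrA ler_wpM2l ?(ltW cV)//.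
  rewrite (le_trans (adjoint_bound bb' c00 hc0 _))// expr2 -mulrA.
  by rewrite ler_wpM2l.
have main : rnorm (tau b') ^+ 2 <= c ^+ 2 * rnorm (tau id) ^+ 2.
  rewrite mulrC -ler_pdivrMr ?exprn_gt0// mulrC.
  apply: (@le_of_eps _ _ _ (rnorm (tau id) * K)) => e e0.
  have [s' [Bs sa _ serr]] := root e e0; have [bs _] := Bs.
  pose h : G -> G := id + (-1) *: s'.
  have hE g : h g = g - s' g by rewrite /h !fctE scaleN1r.
  have Bh : commutant B h.
    apply: (saD sB'); last exact: (saZ sB').
    by apply/commutantP; split => //; exact: bounded_id.
  have hadj : adjoint h = h.
    apply: adjoint_uniq; first by case: Bh.
    by move=> u v; rewrite !hE rdotBr rdotBl sa.
  pose r g := k g + s' (s' g) - 2%:C *: s' g.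
  (* (1 - s')^2 = 1 - k + r, where [r] is the residual of the approximate root. *)
  have hh : tau (adjoint h \o h) = tau id - tau k + tau r.
    rewrite /tau -sumrB -big_split /=; apply: eq_bigr => p _.
    have bt := tensor_bounded p.1.
    rewrite -(bounded_opB bt) -(bounded_opD bt) hadj !hE (bounded_opB bs) /r.
    congr (t _ _); rewrite rmorph_nat scaler_nat mulr2n -[k _ + _ - _]addrA [RHS]addrA subrK.
    by rewrite !opprD opprK !addrA [LHS]addrAC [X in X - _ = _]addrAC.
  have : 0 <= rdot (tau id) (tau (adjoint h \o h)).
    by rewrite -tau_dot// rdot_norm sqr_ge0.
  rewrite hh rdotDr rdotBr rdot_norm.
  have -> : rdot (tau id) (tau k) = c ^- 2 * rnorm (tau b') ^+ 2.
    rewrite -rdot_norm (tau_dot b')// -rdotZr; congr (rdot _ _).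
    rewrite /tau scaler_sumr; apply: eq_bigr => p _.
    by rewrite kE (bounded_opZ (tensor_bounded _)).
  have := rdot_le (tau id) (tau r).
  have := ler_wpM2l (rnorm_ge0 (tau id)) (tau_le r e serr); lra.
rewrite -(ler_pXn2r (ltn0Sn 1)) ?nnegrE ?mulr_ge0 ?rnorm_ge0 ?(ltW c1)//.
by rewrite exprMn.
Qed.

Lemma commutant_repP b' : commutant B b' ->
  bounded_op (commutant_rep t b') /\
  forall x g, commutant_rep t b' (t x g) = t x (b' g).
Proof.
move=> Bb'; have [bb' _] := Bb'; have [c c0 hc] := commutant_rep_le Bb'.
have [||S bS hS] := @extend_tensor_map R E G H H t (fun x => t x \o b') c _ _
    (itensor_dense tensor_t) c0 hc.
- exact: tensor_bounded.
- by move=> x; apply: bounded_comp => //; exact: tensor_bounded.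
pose S' := [set T | bounded_op T /\ forall x g, T (t x g) = t x (b' g)].
by apply: (@xgetPex _ 0 S'); exists S.
Qed.

(** On elementary tensors both sides have equal inner products, as b' commutes with the values of
    [hm_ip]. *)
Lemma commutant_rep_adjoint b' : commutant B b' ->
  adjoint (commutant_rep t b') = commutant_rep t (adjoint b').
Proof.
move=> Bb'; have Ba := sa_adjoint sB' Bb'.
have [br rE] := commutant_repP Bb'; have [ba aE] := commutant_repP Ba.
apply: bounded_op_ext (itensor_dense tensor_t) _ ba _; first exact: adjoint_bounded.
move=> _ [x [g ->]]; apply/eqP; rewrite -subr_eq0; apply/eqP.
apply: (dense_lspan_eq0 (itensor_dense tensor_t)) => _ [y [g' ->]].
rewrite -scaleN1r hdotDl hdotZl -adjointP// rE aE !(itensor_dot tensor_t).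
have [bb' _] := Bb'; have /commutantP[_ comm] := Bb'.
rewrite -adjointP// -comm; last exact: hm_ip_in.
by rewrite rmorphN1 mulN1r subrr.
Qed.

Lemma tensor_intertwines x : intertwiners t (t x).
Proof.
split=> [|b' Bb']; first exact: tensor_bounded.
by apply/funext => g /=; rewrite (commutant_repP Bb').2.
Qed.

Lemma intertwiners_dense :
  dense (lspan [set h | exists (x : {x | intertwiners t x}) g, h = sval x g]).
Proof.
apply: lspan_sub (itensor_dense tensor_t) => _ [x [g ->]].
by exists (exist _ _ (tensor_intertwines x)), g.
Qed.

Lemma intertwinersE x b' g : intertwiners t x -> commutant B b' ->
  commutant_rep t b' (x g) = x (b' g).
Proof. by move=> [_ hx] Bb'; exact: (congr1 (fun f => f g) (hx _ Bb')). Qed.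

Lemma intertwinersD x y : intertwiners t x -> intertwiners t y -> intertwiners t (x + y).
Proof.
move=> Mx My; split=> [|b' Bb']; first by apply: bounded_add; [case: Mx|case: My].
apply/funext => g; rewrite !fctE /= (bounded_opD (commutant_repP Bb').1).
by rewrite !intertwinersE.
Qed.

Lemma intertwinersM x b : intertwiners t x -> B b -> intertwiners t (x \o b).
Proof.
move=> Mx Bb; split=> [|b' Bb'].
  by apply: bounded_comp; [case: Mx|exact: (sa_bounded sB)].
apply/funext => g /=; rewrite intertwinersE//.
by have /commutantP[_ ->] := Bb'.
Qed.

(** x^* y b' = x^* rho'(b') y = b' x^* y; the second equality is the adjoint of the intertwining
    relation of x for b'^*. Thus x^* y lies in the bicommutant. *)
Lemma intertwiners_ip x y : intertwiners t x -> intertwiners t y ->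
  B (adjoint x \o y).
Proof.
move=> Mx My; have [bx _] := Mx; have [byy _] := My.
apply: bicommutant => //; apply/commutantP; split.
  by apply: bounded_comp => //; exact: adjoint_bounded.
move=> b' Bb' g /=; rewrite -(intertwinersE _ My Bb'); apply: rdot_inj => h.
have [bb' _] := Bb'; have [br _] := commutant_repP Bb'.
rewrite rdotC radjointP// rdotC -(radjointP bx) -(radjointP bx).
rewrite [RHS]rdotC (radjointP br) (commutant_rep_adjoint Bb').
by rewrite (intertwinersE _ Mx (sa_adjoint sB' Bb')) rdotC.
Qed.

Lemma intertwiners_self_dual : self_dual B (intertwiners t)
  (fun (x : G -> H) (b : G -> G) => (x \o b)%FUN)
  (fun x y : G -> H => (adjoint x \o y)%FUN).
Proof.
move=> Phi [PhiB PhiD PhiM [c hc]].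
pose X := {x : G -> H | intertwiners t x}.
have bM (x : X) : bounded_op (sval x) by case: (svalP x).
have bPhi (x : X) : bounded_op (Phi (sval x)).
  exact: (sa_bounded sB (PhiB _ (svalP x))).
(* The absolute value appears because the constant [c] of [bounded_right_linear] may be negative. *)
have single (x : X) g : rnorm (Phi (sval x) g) <= `|c| * rnorm (sval x g).
  have Mx := svalP x; move: g; apply: (paschke_inequality sB) => //.
  - exact: von_neumann_id.
  - exact: intertwiners_ip.
  move=> b beta Bb beta0 hb g.
  have Mxb := intertwinersM Mx Bb; have [bxb _] := Mxb.
  have bPhib := sa_bounded sB (PhiB _ Mxb).
  have ip_le : opnorm (adjoint (sval x \o b) \o (sval x \o b)) <= beta ^+ 2.
    apply: opnorm_le => [|v]; first exact: sqr_ge0.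
    rewrite (le_trans (adjoint_bound bxb beta0 hb _))// expr2 -mulrA.
    by rewrite ler_wpM2l//; exact: hb.
  have -> : Phi (sval x) (b g) = Phi (sval x \o b) g by rewrite PhiM.
  rewrite (le_trans (opnorm_bound bPhib g))// ler_wpM2r ?rnorm_ge0//.
  rewrite (le_trans (hc _ Mxb))// (@le_trans _ _ (`|c| * Num.sqrt (opnorm
    (adjoint (sval x \o b) \o (sval x \o b)))))//.
    by rewrite ler_wpM2r ?sqrtr_ge0// ler_norm.
  rewrite ler_wpM2l// -[leRHS](ger0_norm beta0) -sqrtr_sqr.
  exact: ler_wsqrtr.
have dom (s : seq (X * G)) : rnorm (\sum_(p <- s) Phi (sval p.1) p.2)
    <= `|c| * rnorm (\sum_(p <- s) sval p.1 p.2).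
  have := @sum_domination _ _ _ sB (von_neumann_id vnB ndB) H G X
    (fun x => sval x) (fun x => Phi (sval x)) `|c|.
  move=> /(_ (normr_ge0 c) bM bPhi _ _ _ single s id); apply.
  - by move=> x y; apply: intertwiners_ip; exact: svalP.
  - move=> x y; apply: (saM sB); last exact: PhiB (svalP y).
    exact: (sa_adjoint sB (PhiB _ (svalP x))).
  (* The witness is x b + y; right linearity of [Phi] gives the matching formula on the other
     side. *)
  - move=> x y b Bb; have Mxb := intertwinersM (svalP x) Bb.
    have PhiE := PhiD _ _ Mxb (svalP y); rewrite (PhiM _ _ (svalP x) Bb) in PhiE.
    exists (exist _ _ (intertwinersD Mxb (svalP y))); split=> g; first by [].
    exact: (congr1 (fun f => f g) PhiE).
have [S bS SM] := extend_tensor_map bM bPhi intertwiners_dense (normr_ge0 c) dom.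
have SE x g : intertwiners t x -> S (x g) = Phi x g.
  by move=> Mx; exact: (SM (exist _ x Mx) g).
(* On an elementary tensor this says that [Phi (t x)], an element of [B], commutes with b'. *)
have SB' b' h : commutant B b' -> S (commutant_rep t b' h) = b' (S h).
  move=> Bb'; have [bb' _] := Bb'; have [br rE] := commutant_repP Bb'.
  apply: (congr1 (fun f => f h) (_ : S \o commutant_rep t b' = b' \o S)).
  apply: (bounded_op_ext (itensor_dense tensor_t)); try exact: bounded_comp.
  move=> _ [x [g ->]] /=; rewrite rE !SE; try exact: tensor_intertwines.
  by have /commutantP[_ ->] := Bb'; last exact/PhiB/tensor_intertwines.
(* With y = S^* one gets y^* x = S x = Phi x, and y intertwines by taking adjoints in the relation
   just shown for b'^*. *)
exists (adjoint S); split; first split.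
- split=> [|b' Bb']; first exact: adjoint_bounded.
  have Ba := sa_adjoint sB' Bb'; have [bb' _] := Bb'.
  have [br _] := commutant_repP Bb'.
  apply/funext => g /=; apply: rdot_inj => h.
  rewrite -(radjointP bS) rdotC (radjointP br) (commutant_rep_adjoint Bb') rdotC.
  by rewrite -(radjointP bS) (SB' _ _ Ba) rdotC -radjointP ?(adjointK bb')// rdotC.
- by move=> x Mx; rewrite (adjointK bS); apply/funext => g /=; rewrite SE.
(* Testing against the intertwiners [t x] fixes y^* on all elementary tensors. *)
move=> y [[byy _] hy]; rewrite -(adjointK byy); congr adjoint.
apply: (bounded_op_ext (itensor_dense tensor_t)) => //; first exact: adjoint_bounded.
move=> _ [x [g ->]]; rewrite SE; last exact: tensor_intertwines.
by rewrite (hy _ (tensor_intertwines x)).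
Qed.

End Intertwiners.

Theorem proposition3p2 (R : realType) (G : hilbertType R) (B : set (G -> G))
    (vnB : von_neumann_algebra B) (ndB : acts_nondegenerately B)
    (E : hilbertModule B) (H : hilbertType R)
    (t : E -> G -> H) (tensor_t : interior_tensor t) :
  self_dual B (intertwiners t)
    (fun (x : G -> H) (b : G -> G) => (x \o b)%FUN)
    (fun x y : G -> H => (adjoint x \o y)%FUN).
Proof. exact: intertwiners_self_dual. Qed.
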